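(* Let $v_1,\dots,v_m\in\mathbb{Z}^n$ generate a pointed cone $C=\mathbb{R}_+v_1+\dots+\mathbb{R}_+v_m$, let $\delta$ be a primitive $\mathbb{Z}$-linear form on $\mathbb{Z}^n$ with $\delta(x)>0$ for all nonzero $x\in C$ and $\delta(v_i)=1$ for all $i$, and let $P=\{x\in C:\delta(x)=1\}$. Then the descent algorithm described in the context, applied to $P$, computes the lattice normalized volume of $P$ correctly: upon termination the accumulated value equals $\operatorname{Vol}(P)$.
   Context: Descent algorithm. It generates successive sets $\mathcal{D}_0,\mathcal{D}_1,\dots$ of faces of $P$, each face $F$ in them carrying a weight $w(F)$. Start with $\mathcal{D}_0=\{P\}$, $w(P)=1$, and accumulated volume $V=0$. For $i=0,1,2,\dots$: if $\mathcal{D}_i=\emptyset$, stop and return $V$. Otherwise start with $\mathcal{D}_{i+1}=\emptyset$, and for each face $F\in\mathcal{D}_i$ (processed in any order) do the following. (1) If $F$ is a simplex, add $w(F)\operatorname{Vol}(F)$ to $V$; nothing more is done with $F$. (2) Otherwise find the facets $G$ of $F$. (3) Select a vertex $v=v(F)$ of $F$ that minimizes the number of facets of $F$ not containing $v$ and, among these vertices, minimizes the number of faces $F'\in\mathcal{D}_i$ containing $v$. (4) For each facet $G$ of $F$ not containing $v$: (a) compute $\operatorname{Ht}_G(v)$; (b) if $G$ is not yet in $\mathcal{D}_{i+1}$ (i.e. has not been found from an already processed face of $\mathcal{D}_i$), insert $G$ with $w(G)=0$ into $\mathcal{D}_{i+1}$; (c) increase $w(G)$ by $w(F)\operatorname{Ht}_G(v)$.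 Terminology. A cone is pointed if $\{0\}$ is the only vector subspace contained in it. A $\mathbb{Z}$-linear form on a lattice $L$ is primitive if it takes the value $1$ on $L$. A simplex of dimension $r$ is a polytope of dimension $r$ with exactly $r+1$ vertices. Facets are maximal proper faces. Polytopes are nonempty (so $C\neq\{0\}$). $\operatorname{aff}(X)$ denotes the affine hull. A polytope is rational if its vertices lie in $\mathbb{Q}^n$. Lattice (normalized) volume. Let $Q$ be a rational polytope, $A=\operatorname{aff}(Q)$, $r=\dim Q$. If $0\in A$, then $L=A\cap\mathbb{Z}^n$ is a subgroup of $\mathbb{Z}^n$ of rank $r$; choose a $\mathbb{Z}$-basis $e_1,\dots,e_r$ of $L$. The lattice volume $\operatorname{Vol}$ on $A$ is the Lebesgue measure on $A$ scaled so that the simplex $\operatorname{conv}(0,e_1,\dots,e_r)$ has measure $1$ (this is independent of the basis). If $0\notin A$, replace $A$ by a translate $A-w$ with $w\in A$ and set $\operatorname{Vol}(X)=\operatorname{Vol}(X-w)$ for $X\subset A$ (independent of $w$). A single rational point has lattice volume $1$. The volume of a polytope is always taken in its own affine hull. Lattice height. Let $H\ne\emptyset$ be a rational affine subspace of $\mathbb{R}^n$ and $x\in\mathbb{R}^n$ a point such that $A=\operatorname{aff}(H\cup\{x\})$ is a rational affine subspace. If $x\in H$, set $\operatorname{Ht}_H(x)=0$. Otherwise $H$ is a hyperplane in $A$. If $0\in A$, then $H$ is cut out from $A$ by an equation $\lambda(y)=\beta$, where $\lambda$ is a primitive $\mathbb{Z}$-linear form on $A\cap\mathbb{Z}^n$;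 set $\operatorname{Ht}_H(x)=|\lambda(x)-\beta|$. If $0\notin A$, choose $w\in A$ and replace $A,H,x$ by $A-w,H-w,x-w$. For a nonempty face $G$ of a rational polytope, $\operatorname{Ht}_G(x)=\operatorname{Ht}_{\operatorname{aff}(G)}(x)$. *)

(* Defs.v *)
From Stdlib Require Export Relation_Operators.
From HB Require Import structures.
From mathcomp Require Export all_boot all_order all_algebra.
From mathcomp Require Export all_classical all_reals all_analysis.
Import Order.TTheory GRing.Theory Num.Theory.

Set Implicit Arguments.
Unset Strict Implicit.
Unset Printing Implicit Defensive.

Local Open Scope classical_set_scope.
Local Open Scope ring_scope.

(* R^n is 'rV[R]_n, and Z^n is 'rV[int]_n, embedded in it by toR. *)

Definition toR (R : realType) (m n : nat) (M : 'M[int]_(m, n)) : 'M[R]_(m, n) :=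
  map_mx intr M.

Section Polytopes.
Variables (R : realType) (n : nat).
Implicit Types (X Q F G H A : set 'rV[R]_n) (x v w : 'rV[R]_n).

Definition aff X : set 'rV[R]_n :=
  [set x | exists (k : nat) (a : 'I_k -> R) (p : 'I_k -> 'rV[R]_n),
    [/\ forall i, X (p i), \sum_i a i = 1 & x = \sum_i a i *: p i]].

Definition conv_hull X : set 'rV[R]_n :=
  [set x | exists (k : nat) (a : 'I_k -> R) (p : 'I_k -> 'rV[R]_n),
    [/\ forall i, X (p i), forall i, 0 <= a i, \sum_i a i = 1
      & x = \sum_i a i *: p i]].

Definition cone (m : nat) (v : 'I_m -> 'rV[int]_n) : set 'rV[R]_n :=
  [set x | exists2 c : 'I_m -> R,
    (forall i, 0 <= c i) & x = \sum_i c i *: toR R (v i)].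

Definition pointed X : Prop :=
  forall U : {vspace 'rV[R]_n}, (forall x, x \in U -> X x) -> U = 0%VS.

(* Dimension of aff X; the value is meaningful only for nonempty X. *)
Definition adim X : nat :=
  xget 0%N [set r | exists w (U : {vspace 'rV[R]_n}),
    aff X = [set w + u | u in [set u | u \in U]] /\ \dim U = r].

(* The zero form gives the improper faces Q and set0. *)
Definition face Q F : Prop :=
  exists (l : {scalar 'rV[R]_n}) (c : R),
    (forall x, Q x -> l x <= c) /\ F = Q `&` [set x | l x = c].

Definition facet F G : Prop :=
  [/\ face F G, G <> F
    & forall G', face F G' -> G' <> F -> G `<=` G' -> G' = G].

Definition vertex F v : Prop := face F [set v].

Definition simplex F : Prop := ([set v | vertex F v] #= `I_(adim F).+1)%card.

(* The point by which an affine subspace A is translated to make it linear. *)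
Definition base_point A w : Prop := A w /\ (A 0 -> w = 0).

(* (A - w) `&` Z^n *)
Definition lattice_of A w : set 'rV[int]_n := [set z | A (w + toR R z)].

(* The rows of e form a Z-basis of L. *)
Definition lattice_basis (L : set 'rV[int]_n) (r : nat) (e : 'M[int]_(r, n)) :
    Prop :=
  set_bij [set: 'rV[int]_r] L (fun a => a *m e).

(* A Z-linear form on a subgroup L of Z^n is represented by a linear form on R^n
   extending it.  Such an extension exists whenever L is the group of integral
   points of a linear subspace, and it is determined on the span of L. *)
Definition primitive_form (L : set 'rV[int]_n) (l : {scalar 'rV[R]_n}) : Prop :=
  (forall z, L z -> l (toR R z) \is a Num.int) /\
  exists2 z, L z & l (toR R z) = 1.

End Polytopes.

Arguments cone R {n m} v.

(* Lebesgue measure on R^r as an iterated product measure: the recursion unfolds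
   (mu \x nu) A = \int[mu]_x nu (xsection A x).  Only its values on Borel sets
   are meaningful. *)
Fixpoint lebesgue_rV (R : realType) (r : nat) : set 'rV[R]_r -> \bar R :=
  match r return set 'rV[R]_r -> \bar R with
  | 0%N => fun S => (\1_S (0 : 'rV[R]_0))%:E
  | r'.+1 => fun S =>
      (\int[@lebesgue_measure R]_x
         lebesgue_rV [set y : 'rV[R]_r' | S (row_mx (x%:M : 'rV[R]_1) y)])%E
  end.

Section LatticeVolumeHeight.
Variables (R : realType) (n : nat).
Implicit Types (Q H : set 'rV[R]_n) (x w : 'rV[R]_n).

(* Coordinates of the points of a set with respect to the rows of e. *)
Definition coords (r : nat) (e : 'M[int]_(r, n)) (X : set 'rV[R]_n) :
    set 'rV[R]_r :=
  [set t | X (t *m toR R e)].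

(* The choices of w and e do not affect the value. *)
Definition lattice_volume Q : R :=
  xget 0 [set vol | exists w (e : 'M[int]_(adim Q, n)),
    [/\ base_point (aff Q) w, lattice_basis (lattice_of (aff Q) w) e
      & vol = fine (lebesgue_rV (coords e [set y | Q (w + y)])) /
              fine (lebesgue_rV (coords e
                (conv_hull ([set 0] `|` [set toR R (row i e) | i in setT]))))]].

(* The choices of w, l and b do not affect the value. *)
Definition lattice_height H x : R :=
  let A := aff (H `|` [set x]) in
  if x \in H then 0 else
  xget 0 [set h | exists w (l : {scalar 'rV[R]_n}) (b : R),
    [/\ base_point A w, primitive_form (lattice_of A w) l,
        forall y, A (w + y) -> (H (w + y) <-> l y = b)
      & h = `|l (x - w) - b|]].

End LatticeVolumeHeight.

Section Descent.
Variables (R : realType) (n : nat).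
Notation face_set := (set (set 'rV[R]_n)).
Notation weight := (set 'rV[R]_n -> R).

Definition opposite_facets (F : set 'rV[R]_n) (v : 'rV[R]_n) : face_set :=
  [set G | facet F G /\ ~ G v].

Definition faces_through (D : face_set) (v : 'rV[R]_n) : face_set :=
  [set F | D F /\ F v].

(* Lexicographic minimality among the vertices of F. *)
Definition selectable (D : face_set) (F : set 'rV[R]_n) (v : 'rV[R]_n) : Prop :=
  vertex F v /\ forall u, vertex F u ->
    (opposite_facets F v #<= opposite_facets F u)%card /\
    ((opposite_facets F u #<= opposite_facets F v)%card ->
     (faces_through D v #<= faces_through D u)%card).

(* Level D w V: the faces D, with weights w, are about to be processed, and V is
   the volume accumulated so far.
   Processing D w T D' w' V: the faces in T are those of D still to be processed;
   D' and w' are the next set of faces and its weights, under construction.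
   Weights are irrelevant outside the set of faces that carries them. *)
Inductive state : Type :=
| Level (D : face_set) (w : weight) (V : R)
| Processing (D : face_set) (w : weight) (T : face_set)
    (D' : face_set) (w' : weight) (V : R)
| Return (V : R).

(* The facets opposite to v are updated simultaneously: the update for one of
   them neither reads nor changes the data of another. *)
Definition add_weights (w : weight) (F : set 'rV[R]_n) (v : 'rV[R]_n)
    (D' : face_set) (w' : weight) : weight :=
  fun G =>
    if G \in opposite_facets F v then
      (if G \in D' then w' G else 0) + w F * lattice_height (aff G) v
    else w' G.

(* The nondeterminism covers both the order in which the faces of D are processed
   and the ties in the selection of v. *)
Inductive step : state -> state -> Prop :=
| step_stop w V :
    step (Level set0 w V) (Return V)
| step_start D w V :
    D <> set0 ->
    step (Level D w V) (Processing D w D set0 (fun=> 0) V)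
| step_simplex D w T D' w' V F :
    T F -> simplex F ->
    step (Processing D w T D' w' V)
         (Processing D w (T `\ F) D' w' (V + w F * lattice_volume F))
| step_descend D w T D' w' V F v :
    T F -> ~ simplex F -> selectable D F v ->
    step (Processing D w T D' w' V)
         (Processing D w (T `\ F) (D' `|` opposite_facets F v)
            (add_weights w F v D' w') V)
| step_next D w D' w' V :
    step (Processing D w set0 D' w' V) (Level D' w' V).

Definition initial (P : set 'rV[R]_n) : state := Level [set P] (fun=> 1) 0.

(* Total correctness: no run from P is infinite, and every run that cannot be
   continued has returned val. *)
Definition descent_computes (P : set 'rV[R]_n) (val : R) : Prop :=
  Acc (fun t s => step s t) (initial P) /\
  forall s, clos_refl_trans _ step (initial P) s ->
    (forall t, ~ step s t) -> s = Return val.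

End Descent.

(* Main.v *)
Require Import Defs.
From HB Require Import structures.
From mathcomp Require Import measurable_realfun ring lra.
Import Order.TTheory GRing.Theory Num.Theory.
Import numFieldNormedType.Exports.
(** The heart of the matter is the pyramid formula: for a polytope F that is not a
    point and a vertex v of F, the lattice volume of F is the sum, over the facets G
    of F that do not contain v, of the height of v over G times the lattice volume of
    G ([volume_pyramids]).  Granted this formula, a step of the descent, which replaces
    F by its facets opposite to v and multiplies weights by heights, does not change
    the sum of the accumulated volume and the weighted volumes of the faces still to
    be processed ([step_accounts_for]); initially this sum is the volume of P, and at
    the end it is the returned value.  Facets contain fewer of the generating points
    than the face they come from, so every run ends ([Acc_Level]); and a run can only
    get stuck in a final state, because a face that is not a simplex has a vertex
    ([accounts_for_progress]).

    For the pyramid formula, P is regarded as the section of the cone by the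
    hyperplane where delta is 1, so that faces are cut out by linear forms that are
    nonpositive on the generators.  By Farkas' lemma a point of the span outside the
    cone violates such a form, and tilting the form about the generators where it
    vanishes makes the face it defines a facet ([exists_facet_form]).  So F is the
    intersection of the half-spaces of its facets.  A ray from v leaves F through the
    facet whose height, relative to that of v, drops to zero first; this decomposes F
    into the pyramids with apex v over the opposite facets ([pieceE], [pieces_cover]),
    which overlap in hyperplanes only.

    Each pyramid is measured in lattice coordinates adapted to its base.  A basis of the
    lattice of G extends to one of the lattice of F by one vector, and the primitive
    form that cuts out G is the new coordinate ([frame_extend]).  The change to these
    coordinates has determinant 1 or -1, so it preserves lattice volumes
    ([leb_affine], [lattice_volumeE]); and integration over slices parallel to G gives
    the volume of the pyramid as height times volume of the base, up to a factor that
    depends on the dimension only and appears in the same way in the standard simplex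
    by which volumes are normalised ([piece_volume]). *)

Local Open Scope classical_set_scope.
Local Open Scope ring_scope.

Set Implicit Arguments.
Unset Strict Implicit.
Unset Printing Implicit Defensive.

(** * Lebesgue measure on row vectors *)

Section BorelRows.
Variable R : realType.

(** The sigma-algebra generated by these cylinders is the Borel one.  Generating
    it by coordinates makes a map into row vectors measurable as soon as its
    coordinates are, so no topology on row vectors is involved. *)
Definition coord_cylinders r : set (set 'rV[R]_r) :=
  [set S | exists (i : 'I_r) (B : set (measurableTypeR R)),
     measurable B /\ S = [set t : 'rV[R]_r | B (t 0 i)]].

Notation borel_rV r := (g_sigma_algebraType (@coord_cylinders r)).

Lemma measurable_coord r (i : 'I_r) :
  measurable_fun [set: borel_rV r] (fun t : borel_rV r => (t : 'rV[R]_r) 0 i : measurableTypeR R).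
Proof.
move=> _ B mB; rewrite setTI; apply: sub_sigma_algebra.
by exists i, B.
Qed.

Lemma measurable_rowP d (T : measurableType d) r (f : T -> borel_rV r) :
  (forall i, measurable_fun [set: T] (fun x => (f x : 'rV[R]_r) 0 i : measurableTypeR R)) ->
  measurable_fun [set: T] f.
Proof.
move=> mf; apply: (@measurability _ _ T (borel_rV r) setT f (@coord_cylinders r)); first by [].
move=> _ [_ [i [B [mB ->]]] <-].
exact: (mf i).
Qed.

Definition cons_rV r (z : R * 'rV[R]_r) : 'rV[R]_r.+1 :=
  row_mx (z.1%:M : 'rV[R]_1) z.2.

Definition behead_rV r (t : 'rV[R]_r.+1) : 'rV[R]_r := \row_j t 0 (lift ord0 j).

Lemma cons_rV0 r (z : R * 'rV[R]_r) : cons_rV z 0 0 = z.1.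
Proof.
rewrite /cons_rV mxE; case: splitP => [j|j] //=.
by rewrite ord1 mxE eqxx.
Qed.

Lemma cons_rVS r (z : R * 'rV[R]_r) j : cons_rV z 0 (lift ord0 j) = z.2 0 j.
Proof.
rewrite /cons_rV mxE; case: splitP => [k|k] /=.
  by rewrite ord1.
by rewrite /bump /= !add1n => -[/val_inj->].
Qed.

Lemma cons_rVK r (t : 'rV[R]_r.+1) : cons_rV (t 0 0, behead_rV t) = t.
Proof.
apply/rowP => i; case: (unliftP ord0 i) => [j|] ->; last by rewrite cons_rV0.
by rewrite cons_rVS mxE.
Qed.

Lemma behead_cons_rV r (z : R * 'rV[R]_r) : behead_rV (cons_rV z) = z.2.
Proof. by apply/rowP => i; rewrite mxE cons_rVS. Qed.

Lemma measurable_cons_rV r :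
  measurable_fun [set: measurableTypeR R * borel_rV r]
    (@cons_rV r : measurableTypeR R * borel_rV r -> borel_rV r.+1).
Proof.
apply: measurable_rowP => i; case: (unliftP ord0 i) => [j|] ->.
  rewrite (_ : (fun _ => _) = (fun t : borel_rV r => (t : 'rV[R]_r) 0 j) \o snd); last first.
    by apply/funext => z /=; rewrite cons_rVS.
  by apply: measurableT_comp; [exact: measurable_coord|exact: measurable_snd].
rewrite (_ : (fun _ => _) = fst); first exact: measurable_fst.
by apply/funext => z /=; rewrite cons_rV0.
Qed.

Lemma measurable_uncons_rV r :
  measurable_fun [set: borel_rV r.+1]
    (fun t : borel_rV r.+1 => ((t : 'rV[R]_r.+1) 0 0 : measurableTypeR R, behead_rV t : borel_rV r)).
Proof.
apply: measurable_fun_pair; first exact: measurable_coord.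
apply: measurable_rowP => i; apply: eq_measurable_fun (measurable_coord (lift ord0 i)).
by move=> t _; rewrite mxE.
Qed.

(** Packs the properties of a set function into the structure of a measure;
    the set function is a variable here, so that no other structure that its
    body may carry interferes. *)
Section SigmaFiniteMeasureOf.
Context d (T : measurableType d) (p : set T -> \bar R).
Hypotheses (p0 : p set0 = 0%E) (p_ge0 : forall A, (0 <= p A)%E)
  (p_additive : semi_sigma_additive p) (p_finite : sigma_finite setT p).

Let q := p.
HB.instance Definition _ := isMeasure.Build _ _ _ q p0 p_ge0 p_additive.
HB.instance Definition _ := Measure_isSigmaFinite.Build _ _ _ q p_finite.

Lemma sigma_finite_measure_of :
  {m : {sigma_finite_measure set T -> \bar R} | m = p :> (_ -> _)}.
Proof. by exists q. Qed.

End SigmaFiniteMeasureOf.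

(** The iterated integral that defines [lebesgue_rV] is the product of the
    one-dimensional measure with [lebesgue_rV] in one dimension less,
    transported along [cons_rV].  Being a measure is thus inherited by
    induction, and so is sigma-finiteness, which the product needs. *)
Lemma lebesgue_rV_measure r :
  {m : {sigma_finite_measure set (borel_rV r) -> \bar R} | forall S, m S = lebesgue_rV S}.
Proof.
elim: r => [|r [m mE]].
  exists (dirac (0 : borel_rV 0)) => S.
  by rewrite /= /dirac.
pose c : measurableTypeR R * borel_rV r -> borel_rV r.+1 := @cons_rV r.
pose p : set (borel_rV r.+1) -> \bar R := pushforward (lebesgue_measure \x m)%E c.
have p0 : p set0 = 0%E by rewrite /p /pushforward preimage_set0 measure0.
have mc A : measurable A -> measurable (c @^-1` A).
  by move=> mA; rewrite -[X in measurable X]setTI; apply: measurable_cons_rV.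
have pge A : (0 <= p A)%E by exact: (measure_ge0 (lebesgue_measure \x m)%E (c @^-1` A)).
have psa : semi_sigma_additive p.
  move=> F mF tF mUF; rewrite /p /pushforward preimage_bigcup.
  apply: (@measure_semi_sigma_additive _ _ _ (lebesgue_measure \x m)%E (fun i => c @^-1` F i)).
  - by move=> n; exact: mc.
  - apply/trivIsetP => /= i j _ _ ij; rewrite -preimage_setI.
    by move/trivIsetP : tF => /(_ _ _ _ _ ij) ->//; rewrite preimage_set0.
  - by rewrite -preimage_bigcup; exact: mc.
have psf : sigma_finite [set: borel_rV r.+1] p.
  have /sigma_finiteP[F [FT ndF Ffin]] := sigma_finiteT (@lebesgue_measure R).
  have /sigma_finiteP[G [GT ndG Gfin]] := sigma_finiteT m.
  pose u (t : borel_rV r.+1) := ((t : 'rV[R]_r.+1) 0 0 : measurableTypeR R, behead_rV t : borel_rV r).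
  have cu : cancel c u by move=> [x y]; rewrite /u /c behead_cons_rV cons_rV0.
  exists (fun i => u @^-1` (F i `*` G i)) => [|i].
    apply/seteqP; split => // t _.
    have [i _ Fi] : (\bigcup_i F i) ((t : 'rV[R]_r.+1) 0 0) by rewrite -FT.
    have [j _ Gj] : (\bigcup_i G i) (behead_rV t) by rewrite -GT.
    exists (maxn i j) => //; split => /=.
      by move: Fi; exact/subsetPset/ndF/leq_maxl.
    by move: Gj; exact/subsetPset/ndG/leq_maxr.
  have [mF Foo] := Ffin i; have [mG Goo] := Gfin i.
  split.
    by rewrite -[X in measurable X]setTI; apply: measurable_uncons_rV => //; exact: measurableX.
  rewrite /p /pushforward -comp_preimage (_ : u \o c = id); last by apply/funext => z; exact: cu.
  by rewrite product_measure1E// lte_mul_pinfty// ge0_fin_numE.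
have [p' p'E] := sigma_finite_measure_of p0 pge psa psf.
exists p' => S; rewrite p'E /= /p /pushforward /product_measure1.
apply: eq_integral => x _ /=; rewrite mE; congr lebesgue_rV.
by apply/seteqP; split => y; rewrite /xsection /= ?inE.
Qed.

Definition leb r : {sigma_finite_measure set (borel_rV r) -> \bar R} :=
  proj1_sig (lebesgue_rV_measure r).

Lemma lebE r (S : set 'rV[R]_r) : leb r S = lebesgue_rV S.
Proof. exact: (proj2_sig (lebesgue_rV_measure r)). Qed.

End BorelRows.
Notation borel_rV R r := (g_sigma_algebraType (@coord_cylinders R r)).

(** * Affine changes of variables *)

Section AffineInvariance.
Variable R : realType.
Notation mu := (@lebesgue_measure R).

Lemma measurable_affine_rV r s (A : 'M[R]_(r, s)) (t0 : 'rV[R]_s) :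
  measurable_fun [set: borel_rV R r]
    ((fun t : 'rV[R]_r => t *m A + t0) : borel_rV R r -> borel_rV R s).
Proof.
apply: measurable_rowP => i.
rewrite (_ : (fun _ => _) = (fun t : borel_rV R r =>
    \sum_(k < r) (t : 'rV[R]_r) 0 k * A k i + t0 0 i)); last first.
  by apply/funext => t; rewrite !mxE.
apply: measurable_funD => //; apply: measurable_sum => k.
by apply: measurable_funM => //; exact: measurable_coord.
Qed.

Lemma measurable_preimage_affine r s (A : 'M[R]_(r, s)) (t0 : 'rV[R]_s) S :
  measurable (S : set (borel_rV R s)) ->
  measurable ([set t : 'rV[R]_r | S (t *m A + t0)] : set (borel_rV R r)).
Proof.
by move=> mS; rewrite -[X in measurable X]setTI; exact: measurable_affine_rV.
Qed.

(** Both sides are integrals against translation-invariant measures, and these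
    agree on half-open intervals. *)
Lemma lebesgue_integral_affine (a b : R) (f : R -> \bar R) :
  a != 0 -> measurable_fun [set: measurableTypeR R] f -> (forall x, 0 <= f x)%E ->
  (`|a|%:E * \int[mu]_x f (a * x + b)%R = \int[mu]_x f x)%E.
Proof.
move=> a0 mf f0.
pose phi : measurableTypeR R -> measurableTypeR R := fun x => a * x + b.
have mphi : measurable_fun setT phi by apply: measurable_funD => //; exact: measurable_funM.
have an0 : 0 <= `|a| by [].
pose c : {nonneg R} := NngNum an0.
pose m0 : {measure set (measurableTypeR R) -> \bar R} := pushforward mu phi.
pose m := m0 mphi.
have E A : measurable A -> lebesgue_measure A = mscale c m A.
  apply: lebesgue_measure_unique => _ [[x y] _ <-].
  have Ephi : phi @^-1` `]x, y]%classic =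
    (if 0 < a then `](x - b) / a, (y - b) / a]%classic else `[(y - b) / a, (x - b) / a[%classic) :> set R.
    apply/seteqP; split => z /=; case: ltrgt0P a0 => // ha _; rewrite /phi /= !in_itv /=.
    - by rewrite ltr_pdivrMr// ler_pdivlMr// [z * a]mulrC ltrBlDr lerBrDr.
    - by rewrite ler_ndivrMr// ltr_ndivlMr// [z * a]mulrC ltrBlDr lerBrDr andbC.
    - by rewrite ltr_pdivrMr// ler_pdivlMr// [z * a]mulrC ltrBlDr lerBrDr.
    - by rewrite ler_ndivrMr// ltr_ndivlMr// [z * a]mulrC ltrBlDr lerBrDr andbC.
  transitivity (`|a|%:E * mu (phi @^-1` `]x, y]))%E; last by [].
  rewrite Ephi.
  case: ltrgt0P a0 => // ha _; rewrite !lebesgue_measure_itv /= !lte_fin.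
  - rewrite ltr_pM2r ?invr_gt0// ltrD2r; case: ifP => _; last by rewrite mule0.
    by rewrite -!EFinB -EFinM; congr EFin; field; exact: lt0r_neq0.
  - rewrite ltr_nM2r ?invr_lt0// ltrD2r; case: ifP => _; last by rewrite mule0.
    by rewrite -!EFinB -EFinM; congr EFin; field; exact: ltr0_neq0.
rewrite [RHS](eq_measure_integral (mscale c m)); last by move=> A mA _; exact: E.
rewrite ge0_integral_mscale//= ge0_integral_pushforward//.
Qed.

Lemma leb_slices r (S : set 'rV[R]_r.+1) :
  (leb R r.+1 S = \int[mu]_x leb R r [set y | S (cons_rV (x, y))])%E.
Proof. by rewrite lebE /=; apply: eq_integral => x _; rewrite lebE. Qed.

Lemma measurable_cons_preimage r (S : set 'rV[R]_r.+1) :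
  measurable (S : set (borel_rV R r.+1)) ->
  measurable ([set z : R * 'rV[R]_r | S (cons_rV z)] : set (measurableTypeR R * borel_rV R r)).
Proof.
by move=> mS; rewrite -[X in measurable X]setTI; exact: measurable_cons_rV.
Qed.

Lemma measurable_slice r (S : set 'rV[R]_r.+1) x :
  measurable (S : set (borel_rV R r.+1)) ->
  measurable ([set y | S (cons_rV (x, y))] : set (borel_rV R r)).
Proof.
move=> /measurable_cons_preimage mS.
have := @measurable_xsection _ _ (measurableTypeR R) (borel_rV R r) _ x mS.
by congr (measurable _); apply/seteqP; split => y; rewrite /xsection /= inE.
Qed.

Lemma measurable_leb_slice r (S : set 'rV[R]_r.+1) :
  measurable (S : set (borel_rV R r.+1)) ->
  measurable_fun [set: measurableTypeR R] (fun x : measurableTypeR R => leb R r [set y | S (cons_rV (x, y))]).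
Proof.
move=> /measurable_cons_preimage mS.
have := @measurable_fun_xsection _ _ _ _ _ (leb R r) _ mS.
apply: eq_measurable_fun => x _ /=; congr (leb R r _).
by apply/seteqP; split => y; rewrite /xsection /= inE.
Qed.

(** Tonelli: integrating the first coordinate last or first gives the same
    measure.  Slicing across the first coordinate is what makes shears along
    that coordinate harmless. *)
Lemma leb_cross_slices r (S : set 'rV[R]_r.+1) :
  measurable (S : set (borel_rV R r.+1)) ->
  (leb R r.+1 S = \int[leb R r]_y mu [set x | S (cons_rV (x, y))])%E.
Proof.
move=> /measurable_cons_preimage mS; set S' := [set z | _] in mS.
rewrite leb_slices; transitivity (((mu \x leb R r) S')%E).
  apply: eq_integral => x _ /=; congr (leb R r _).
  by apply/seteqP; split => y; rewrite /xsection /= inE.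
rewrite (@product_measure_unique _ _ _ _ _ mu (leb R r) (mu \x^ leb R r)%E) //.
  apply: eq_integral => y _ /=; congr (mu _).
  by apply/seteqP; split => x; rewrite /ysection /= inE.
by move=> A B mA mB; rewrite /= product_measure2E.
Qed.

(** The change of variables formula for one affine map, in a form without
    division and about preimages, whose measurability is immediate.  The
    translation part is kept, since the induction on blocks produces one. *)
Definition scales_by_det r (A : 'M[R]_r) (t0 : 'rV[R]_r) :=
  forall S, measurable (S : set (borel_rV R r)) ->
    (`|\det A|%:E * leb R r [set t : 'rV[R]_r | S (t *m A + t0)%R] = leb R r S)%E.

Lemma scales_by_detM r (A B : 'M[R]_r) t0 :
  scales_by_det A 0 -> scales_by_det B t0 -> scales_by_det (A *m B) t0.
Proof.
move=> hA hB S mS; rewrite det_mulmx normrM mulrC EFinM -muleA -[RHS]hB//.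
rewrite -(hA [set t : 'rV[R]_r | S (t *m B + t0)]); last exact: measurable_preimage_affine.
by congr (_ * (_ * leb R r _))%E; apply/seteqP; split => t /=; rewrite addr0 mulmxA.
Qed.

(** On the slice of first coordinate [x], a block upper triangular map is the map
    of its lower block followed by a translation depending on [x]; the first
    coordinate itself is only rescaled. *)
Lemma scales_block_upper r (a : R) (b : 'rV[R]_r) (D : 'M[R]_r) (t0 : 'rV[R]_r.+1) :
  a != 0 -> (forall t1, scales_by_det D t1) ->
  scales_by_det (block_mx (a%:M : 'M[R]_1) b 0 D : 'M[R]_r.+1) t0.
Proof.
move=> a0 hD S mS.
rewrite (@det_ublock _ 1 r) det_scalar1 normrM !leb_slices.
pose h x := leb R r [set y | S (cons_rV (x, y))].
rewrite -(@lebesgue_integral_affine a (t0 0 0) h)//; last exact: measurable_leb_slice.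
rewrite EFinM -muleA; congr (_ * _)%E.
rewrite -ge0_integralZl//; last first.
  have := measurable_leb_slice (measurable_preimage_affine
    (block_mx (a%:M : 'M[R]_1) b 0 D : 'M[R]_r.+1) t0 mS).
  by [].
apply: eq_integral => x _.
rewrite /h -(hD (x *: b + behead_rV t0) _ (measurable_slice (a * x + t0 0 0) mS)).
have E y : cons_rV (x, y) *m (block_mx (a%:M : 'M[R]_1) b 0 D : 'M[R]_r.+1) + t0 =
    cons_rV (a * x + t0 0 0, y *m D + (x *: b + behead_rV t0)).
  rewrite -[in LHS](cons_rVK t0) /cons_rV /= (@mul_row_block _ 1 1 r 1 r) (@add_row_mx _ 1 1 r).
  rewrite -scalar_mxM mulmx0 addr0 -raddfD /= [x * a]mulrC.
  by rewrite mul_scalar_mx addrCA addrA.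
congr (_ * leb R r _)%E; apply/seteqP; split => y /=; rewrite E //.
Qed.

Lemma scales_by_det1 r t0 : scales_by_det (1%:M : 'M[R]_r) t0.
Proof.
elim: r t0 => [|r IH] t0.
  move=> S mS; rewrite det1 normr1 mul1e; congr (leb R 0 _).
  by apply/seteqP; split => t /=; rewrite !thinmx0.
rewrite [1%:M](@scalar_mx_block _ 1 r); apply: scales_block_upper => //.
Qed.

(** Along a line parallel to the first axis the shear is a translation. *)
Lemma scales_shear r (c : 'cV[R]_r) :
  scales_by_det (block_mx (1%:M : 'M[R]_1) 0 c 1%:M : 'M[R]_r.+1) 0.
Proof.
move=> S mS; rewrite (@det_lblock _ 1 r) !det1 mulr1 normr1 mul1e.
rewrite !leb_cross_slices//; last exact: measurable_preimage_affine.
apply: eq_integral => y _.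
have mSy : measurable ([set x | S (cons_rV (x, y))] : set (measurableTypeR R)).
  have := @measurable_ysection _ _ (measurableTypeR R) (borel_rV R r) _ y (measurable_cons_preimage mS).
  by congr (measurable _); apply/seteqP; split => x; rewrite /ysection /= inE.
have E x : cons_rV (x, y) *m (block_mx (1%:M : 'M[R]_1) 0 c 1%:M : 'M[R]_r.+1) + 0 =
    cons_rV (1 * x + (y *m c) 0 0, y).
  rewrite addr0 /cons_rV /= (@mul_row_block _ 1 1 r 1 r) mulmx0 add0r !mulmx1 mul1r.
  by rewrite raddfD /= -mx11_scalar.
have mphi : measurable_fun setT (fun x : measurableTypeR R => (1 * x + (y *m c) 0 0) : measurableTypeR R).
  by apply: measurable_funD => //; exact: measurable_funM.
have indicI B : measurable B -> mu B = (\int[mu]_x (\1_B x)%:E)%E.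
  by move=> mB; rewrite integral_indic// setIT.
rewrite [RHS]indicI// -(@lebesgue_integral_affine 1 ((y *m c) 0 0)).
- rewrite normr1 mul1e indicI; last first.
    have := mphi measurableT _ mSy; rewrite setTI; congr (measurable _).
    by apply/seteqP; split => x /=; rewrite E.
  apply: eq_integral => x _; congr (_%:E); rewrite !indicE; congr (_%:R).
  by congr nat_of_bool; apply/idP/idP; rewrite !inE /= E.
- exact: oner_neq0.
- by apply/measurable_EFinP; exact: measurable_indic.
- by move=> x; rewrite lee_fin.
Qed.

(** Linear change of variables.  Up to a first shear that makes the top left
    entry nonzero, one step of Gaussian elimination writes a matrix as a shear
    along the first coordinate times a block upper triangular matrix, whose
    lower block is covered by induction. *)
Lemma leb_affine r (A : 'M[R]_r) (t0 : 'rV[R]_r) :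
  A \in unitmx -> scales_by_det A t0.
Proof.
elim: r A t0 => [|r IH] A t0 uA.
  by rewrite (flatmx0 A) -(flatmx0 1%:M); exact: scales_by_det1.
pose A' : 'M[R]_(1 + r) := A.
(* Adding a multiple of another row to the first one makes the pivot nonzero. *)
have [s sP] : exists s : 'rV[R]_r, (ulsubmx A' + s *m dlsubmx A') 0 0 != 0.
  have [a0|a0] := boolP (ulsubmx A' 0 0 == 0); last by exists 0; rewrite mul0mx addr0.
  have [c0|] := boolP (dlsubmx A' == 0).
    exfalso; move: uA; rewrite unitmxE unitfE (expand_det_col _ 0) big_ord_recl.
    move/eqP: a0; rewrite !mxE.
    rewrite (_ : lshift r 0 = 0); last exact: val_inj.
    move=> ->; rewrite mul0r add0r big1 ?eqxx// => i _.
    move/eqP/matrixP/(_ i 0): c0; rewrite !mxE.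
    rewrite (_ : lshift r 0 = 0); last exact: val_inj.
    rewrite (_ : rshift 1 i = lift ord0 i); last exact: val_inj.
    by move=> ->; rewrite mul0r.
  case/matrix0Pn => i [j]; rewrite ord1 => cij.
  exists (delta_mx 0 i); rewrite [X in X != 0]mxE (eqP a0) add0r mxE (bigD1 i)//= big1 ?addr0.
    by rewrite mxE !eqxx mul1r.
  by move=> k ki; rewrite mxE (negbTE ki) andbF mul0r.
set a := _ 0 0 in sP.
pose U := block_mx (1%:M : 'M[R]_1) s 0 1%:M : 'M[R]_(1 + r).
pose U' := block_mx (1%:M : 'M[R]_1) (- s) 0 1%:M : 'M[R]_(1 + r).
pose c := a^-1 *: dlsubmx A'.
pose b := ursubmx A' + s *m drsubmx A'.
pose L := block_mx (1%:M : 'M[R]_1) 0 c 1%:M : 'M[R]_(1 + r).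
pose D := drsubmx A' - c *m b.
pose V := block_mx (a%:M : 'M[R]_1) b 0 D : 'M[R]_(1 + r).
have AE : A = U' *m (L *m V).
  rewrite -[A in LHS]/A' -[A' in LHS]submxK /U' /L /V !mulmx_block.
  rewrite !mul1mx !mul0mx ?mulmx0 ?addr0 ?add0r.
  have aE : a%:M = ulsubmx A' + s *m dlsubmx A' by rewrite -mx11_scalar.
  have caE : c *m a%:M = dlsubmx A' by rewrite mul_mx_scalar scalerA mulfV// scale1r.
  have DE : c *m b + D = drsubmx A' by rewrite addrC subrK.
  by rewrite DE caE aE !mulNmx /b !addrK.
have uD : D \in unitmx.
  move: uA; rewrite !unitmxE AE !det_mulmx (@det_ublock _ 1 r) (@det_lblock _ 1 r) (@det_ublock _ 1 r).
  by rewrite !det1 det_scalar1 !mul1r !unitfE mulf_eq0 negb_or => /andP[].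
rewrite AE; apply: scales_by_detM; first apply: scales_block_upper.
- exact: oner_neq0.
- exact: scales_by_det1.
apply: scales_by_detM; first exact: scales_shear.
by apply: scales_block_upper => // t1; exact: IH.
Qed.
End AffineInvariance.

(** * Measures of polyhedra and pyramids *)

Section RowMeasure.
Variable R : realType.
Notation mu := (@lebesgue_measure R).

Lemma measurable_forall d (T : measurableType d) (J : finType) (A : J -> set T) :
  (forall j, measurable (A j)) -> measurable [set t | forall j, A j t].
Proof.
move=> mA; rewrite (_ : [set t | _] = \bigcap_(j in [set: J]) A j).
  by apply: fin_bigcap_measurable.
by apply/seteqP; split => t /= At j; [move=> _|]; exact: At.
Qed.

Lemma measurable_halfspace r (c : 'cV[R]_r) (b : R) :
  measurable ([set t : 'rV[R]_r | (t *m c) 0 0 <= b] : set (borel_rV R r)).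
Proof.
have m1 : measurable ([set t : 'rV[R]_1 | t 0 0 <= b] : set (borel_rV R 1)).
  apply: sub_sigma_algebra; exists 0, [set x : R | x <= b]; split => //.
  by rewrite -set_itvNyc; exact: measurable_itv.
have := measurable_preimage_affine c 0 m1.
by congr (measurable _); apply/seteqP; split => t /=; rewrite addr0.
Qed.

Lemma measurable_hyperplane r (c : 'cV[R]_r) (b : R) :
  measurable ([set t : 'rV[R]_r | (t *m c) 0 0 = b] : set (borel_rV R r)).
Proof.
rewrite (_ : [set t | _] = [set t : 'rV[R]_r | (t *m c) 0 0 <= b] `&`
   [set t : 'rV[R]_r | (t *m - c) 0 0 <= - b]).
  by apply: measurableI; exact: measurable_halfspace.
apply/seteqP; split => t /=; rewrite mulmxN [in X in _ /\ X]mxE lerN2.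
  by move=> ->.
by case=> h1 h2; apply/eqP; rewrite eq_le h1.
Qed.

(** If the normal vector has a nonzero first entry, the hyperplane meets every
    line parallel to the first axis in one point; otherwise its slices are
    hyperplanes. *)
Lemma leb_hyperplane r (c : 'cV[R]_r) (b : R) :
  c != 0 -> leb R r [set t : 'rV[R]_r | (t *m c) 0 0 = b] = 0%E.
Proof.
elim: r c b => [|r IH] c b c0; first by move: c0; rewrite flatmx0 eqxx.
pose c' : 'cV[R]_r := \col_i c (lift ord0 i) 0.
have E x y : (cons_rV (x, y) *m c) 0 0 = x * c 0 0 + (y *m c') 0 0.
  rewrite mxE big_ord_recl cons_rV0 /= [in RHS]mxE; congr (_ + _).
  by apply: eq_bigr => i _; rewrite cons_rVS mxE.
have [c00|c00] := eqVneq (c 0 0) 0.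
  rewrite leb_slices; apply: integral0_eq => x _.
  rewrite (_ : [set y | _] = [set y | (y *m c') 0 0 = b]); last first.
    by apply/seteqP; split => y /=; rewrite E c00 mulr0 add0r.
  apply: IH; apply: contra c0 => /eqP c'0; apply/eqP/colP => i.
  rewrite [RHS]mxE; case: (unliftP ord0 i) => [j|] -> //.
  by move/colP/(_ j): c'0; rewrite !mxE.
rewrite leb_cross_slices; last exact: measurable_hyperplane.
apply: integral0_eq => y _.
rewrite (_ : [set x | _] = [set (b - (y *m c') 0 0) / c 0 0]); first exact: lebesgue_measure_set1.
apply/seteqP; split => x /=; rewrite E.
  by move=> <-; rewrite addrK mulfK.
by move=> ->; rewrite divfK// subrK.
Qed.

Lemma measurable_box r (K : R) :
  measurable ([set t : 'rV[R]_r | forall i, `|t 0 i| <= K] : set (borel_rV R r)).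
Proof.
apply: measurable_forall => i; apply: sub_sigma_algebra.
exists i, [set x : R | `|x| <= K]; split => //.
rewrite (_ : [set x | _] = `[- K, K]%classic); first exact: measurable_itv.
by apply/seteqP; split => x /=; rewrite in_itv /= ler_norml.
Qed.

(** Serves to show that polytopes have finite measure, so that [fine] is additive
    on them. *)
Lemma leb_box_lty r (K : R) : (leb R r [set t : 'rV[R]_r | forall i, (`|t 0 i| <= K)%R] < +oo)%E.
Proof.
elim: r => [|r IH].
  rewrite lebE /= indicE; case: (_ \in _); exact: ltry.
rewrite leb_slices.
set B := [set t : 'rV[R]_r | _] in IH.
have mB : measurable (B : set (borel_rV R r)) by exact: measurable_box.
under eq_integral => x _.
  rewrite (_ : leb R r _ = leb R r B * (\1_(`[- K, K]%classic : set R) x)%:E)%E.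
    over.
  rewrite indicE; case: (boolP (x \in _)); last rewrite notin_setE /= in_itv /= -ler_norml.
    rewrite inE /= in_itv /= -ler_norml => xK; rewrite mule1; congr (leb R r _); apply/seteqP; split => y /= h i.
      by have := h (lift ord0 i); rewrite cons_rVS.
    by case: (unliftP ord0 i) => [j|] ->; rewrite ?cons_rVS ?cons_rV0.
  move=> xK; rewrite mule0 (_ : [set y | _] = set0) ?measure0//.
  apply/seteqP; split => y //= /(_ 0); rewrite cons_rV0 /= => h.
  exact: xK h.
rewrite ge0_integralZl//=; last first.
  by apply/measurable_EFinP; exact: measurable_indic.
rewrite integral_indic//= setIT lebesgue_measure_itv /=.
apply: lte_mul_pinfty => //; first by rewrite ge0_fin_numE.
by case: ifP => // _; rewrite -EFinB ltry.
Qed.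

Lemma leb_bounded_fin r (S : set 'rV[R]_r) (K : R) :
  measurable (S : set (borel_rV R r)) -> (forall t, S t -> forall i, `|t 0 i| <= K) ->
  leb R r S \is a fin_num.
Proof.
move=> mS SK; rewrite ge0_fin_numE//; apply: le_lt_trans (leb_box_lty r K).
by apply: le_measure; rewrite ?inE //; exact: measurable_box.
Qed.

(** The pyramids that decompose a polytope share boundary pieces, so that additivity
    is needed for sets that are disjoint up to null sets only. *)
Lemma measure_null_overlap d (T : measurableType d) (m : {measure set T -> \bar R})
    (I : choiceType) (s : seq I) (A : I -> set T) :
  uniq s -> (forall i, i \in s -> measurable (A i)) ->
  (forall i j, i \in s -> j \in s -> i != j -> m (A i `&` A j) = 0%E) ->
  m [set x | exists2 i, i \in s & A i x] = (\sum_(i <- s) m (A i))%E.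
Proof.
elim: s A => [|i s IH] A /=.
  move=> _ _ _; rewrite big_nil (_ : [set x | _] = set0) ?measure0//.
  by apply/seteqP; split => x //= -[i].
move=> /andP[is_ us] mA mI; rewrite big_cons.
set U := [set x | exists2 j, j \in s & A j x].
have -> : [set x | exists2 j, j \in i :: s & A j x] = A i `|` U.
  apply/seteqP; split => x /=.
    move=> [j]; rewrite inE => /orP[/eqP->|js] Aj; [by left|right; by exists j].
  by case=> [Ai|[j js Aj]]; [exists i; rewrite ?mem_head|exists j; rewrite ?inE ?js ?orbT].
have UE (B : I -> set T) : [set x | exists2 j, j \in s & B j x] = \big[setU/set0]_(j <- s) B j.
  rewrite -bigcup_seq; apply/seteqP; split => x /= [j]; by exists j.
have mU : measurable U.
  rewrite /U UE big_seq; apply: bigsetU_measurable => j js; apply: mA; by rewrite inE js orbT.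
have mi : measurable (A i) by apply: mA; rewrite mem_head.
rewrite -IH//; first last.
- by move=> j k js ks; apply: mI; rewrite inE ?js ?ks orbT.
- by move=> j js; apply: mA; rewrite inE js orbT.
have AU0 : m (A i `&` U) = 0%E.
  rewrite (_ : _ `&` _ = [set x | exists2 j, j \in s & (A i `&` A j) x]); last first.
    apply/seteqP; split => x /=; first by case=> Ai [j js Aj]; exists j.
    by case=> j js [Ai Aj]; split => //; exists j.
  have ij j : j \in s -> i != j by move=> js; apply: contraNneq is_ => ->.
  have mAs j : j \in s -> measurable (A j) by move=> js; apply: mA; rewrite inE js orbT.
  rewrite IH//.
  - rewrite big_seq big1 // => j js; apply: mI; rewrite ?mem_head ?ij//.
    by rewrite inE js orbT.
  - by move=> j js; apply: measurableI => //; exact: mAs.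
  - move=> j k js ks jk; apply: (@subset_measure0 _ _ _ _ _ (A j `&` A k)).
    + by apply: measurableI; apply: measurableI => //; exact: mAs.
    + by apply: measurableI; exact: mAs.
    + by move=> x [[_ ?] [_ ?]].
    + by apply: mI; rewrite // inE ?js ?ks orbT.
have Ei : m (A i) = m (A i `\` U).
  by rewrite [LHS](measureDI m mi mU) [X in (_ + X)%E]AU0 adde0.
rewrite -/U Ei -measureU//.
- congr (m _); apply/seteqP; split => x [Ai|Ux]; try by right.
    by have [Ux|nUx] := pselect (U x); [right|left].
  by left; case: Ai.
- exact: measurableD.
- by rewrite setDE -setIA setICl setI0.
Qed.

(** The measure of a pyramid of height 1 over a base of measure 1 in dimension
    [r]; its value is 1 / (r + 1), but any positive finite value common to all
    pyramids cancels in the normalisation of lattice volumes. *)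
Definition pyramid_factor r : \bar R := (\int[mu]_(x in `[0%R, 1%R[) ((1 - x) ^+ r)%:E)%E.

Let measurable_pow r : measurable_fun [set: measurableTypeR R] (fun x : measurableTypeR R => (1 - x) ^+ r).
Proof. by apply: measurable_funX; apply: measurable_funB. Qed.

Lemma pyramid_factor_gt0 r : (0 < pyramid_factor r)%E.
Proof.
pose h : R := 2^-1.
have h0 : 0 < h by rewrite invr_gt0.
have h1 : h < 1 by rewrite invf_lt1// ltr1n.
have mpow D : measurable_fun D (fun x : measurableTypeR R => ((1 - x) ^+ r)%:E).
  by apply/measurable_EFinP; exact: measurable_funS (measurable_pow r).
apply: (@lt_le_trans _ _ (\int[mu]_(x in `[0%R, h[) (h ^+ r)%:E)%E).
  rewrite integral_cst//= lebesgue_measure_itv /= lte_fin h0 sube0 -EFinM lte_fin.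
  by rewrite mulr_gt0// exprn_gt0.
apply: (@le_trans _ _ (\int[mu]_(x in `[0%R, h[) ((1 - x) ^+ r)%:E)%E).
  apply: ge0_le_integral => //=.
  - by move=> x _; rewrite lee_fin exprn_ge0// ltW.
  - move=> x; rewrite in_itv /= => /andP[x0 xh]; rewrite lee_fin.
    apply: lerXn2r; rewrite ?nnegrE; [exact: ltW|by rewrite subr_ge0 ltW// (lt_trans xh)|].
    rewrite lerBrDr; apply: le_trans (_ : h + h <= 1); first by rewrite lerD2l ltW.
    by rewrite /h; lra.
apply: ge0_subset_integral => //=.
  move=> x; rewrite in_itv /= => /andP[x0 xh]; rewrite lee_fin exprn_ge0// subr_ge0.
  by apply: ltW.
by apply: subset_itvl; rewrite bnd_simp ltW.
Qed.

Lemma pyramid_factor_lty r : (pyramid_factor r < +oo)%E.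
Proof.
apply: (@le_lt_trans _ _ (\int[mu]_(x in `[0%R, 1%R[) 1%:E)%E); last first.
  by rewrite integral_cst//= lebesgue_measure_itv /= lte_fin ltr01 sube0 mule1 ltry.
apply: ge0_le_integral => //=.
- move=> x; rewrite in_itv /= => /andP[x0 x1]; rewrite lee_fin exprn_ge0// subr_ge0.
  exact: ltW.
- by apply/measurable_EFinP; exact: measurable_funS (measurable_pow r).
- move=> x; rewrite in_itv /= => /andP[x0 x1]; rewrite lee_fin exprn_ile1 ?subr_ge0 ?(ltW x1)//.
  by rewrite lerBlDr lerDl.
Qed.

Lemma leb_dilation r (a : R) (B : set 'rV[R]_r) :
  0 < a -> measurable (B : set (borel_rV R r)) ->
  leb R r [set t : 'rV[R]_r | B (a^-1 *: t)] = ((a ^+ r)%:E * leb R r B)%E.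
Proof.
move=> a0 mB.
have uA : (a^-1%:M : 'M[R]_r) \in unitmx.
  by rewrite unitmxE det_scalar unitrX// unitfE invr_eq0 gt_eqF.
rewrite -(leb_affine 0 uA mB) det_scalar ger0_norm; last first.
  by rewrite exprn_ge0// invr_ge0 ltW.
rewrite muleA -EFinM -exprMn mulfV ?gt_eqF// expr1n mul1e.
by congr (leb R r _); apply/seteqP; split => t /=; rewrite addr0 mul_mx_scalar.
Qed.

(** [S] is the pyramid with apex at the first unit vector over the base [B] in the
    coordinate hyperplane: its slice at [x] is the base shrunk by [1 - x]. *)
Lemma leb_pyramid r (S : set 'rV[R]_r.+1) (B : set 'rV[R]_r) :
  measurable (S : set (borel_rV R r.+1)) -> measurable (B : set (borel_rV R r)) ->
  (forall x y, S (cons_rV (x, y)) -> 0 <= x <= 1) ->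
  (forall x y, 0 <= x < 1 -> S (cons_rV (x, y)) <-> B ((1 - x)^-1 *: y)) ->
  leb R r.+1 S = (pyramid_factor r * leb R r B)%E.
Proof.
move=> mS mB S01 SB; rewrite leb_slices.
set g := fun x => leb R r _.
have mg D : measurable_fun D (g : measurableTypeR R -> _).
  by apply: measurable_funS (measurable_leb_slice mS).
have -> : (\int[mu]_x g x = \int[mu]_(x in `[0%R, 1%R]) g x)%E.
  rewrite [RHS]integral_mkcond; apply: eq_integral => x _.
  rewrite patchE; case: ifPn => //; rewrite notin_setE /= in_itv /= => x01.
  rewrite /g (_ : [set y | _] = set0) ?measure0//.
  by apply/seteqP; split => y //= /S01.
rewrite -(integral_itv_bndo_bndc (mg _)) /pyramid_factor muleC.
rewrite -ge0_integralZl//.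
- apply: eq_integral => x; rewrite inE /= in_itv /= => /andP[x0 x1].
  rewrite muleC -leb_dilation ?subr_gt0//; congr (leb R r _); apply/seteqP; split => y /=.
    by rewrite SB ?x0.
  by rewrite -SB ?x0.
- by apply/measurable_EFinP; exact: measurable_funS (measurable_pow r).
- move=> x; rewrite /= in_itv /= => /andP[x0 x1]; rewrite lee_fin exprn_ge0// subr_ge0.
  exact: ltW.
Qed.

Definition std_simplex r : set 'rV[R]_r :=
  [set t | (forall i, 0 <= t 0 i) /\ \sum_i t 0 i <= 1].

Lemma measurable_std_simplex r : measurable (@std_simplex r : set (borel_rV R r)).
Proof.
rewrite (_ : @std_simplex r = [set t : 'rV[R]_r | forall i, (t *m - (delta_mx i 0 : 'cV[R]_r)) 0 0 <= 0] `&`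
   [set t : 'rV[R]_r | (t *m (const_mx 1 : 'cV[R]_r)) 0 0 <= 1]).
  apply: measurableI; last exact: measurable_halfspace.
  by apply: measurable_forall => i; exact: measurable_halfspace.
have E1 (t : 'rV[R]_r) i : (t *m - (delta_mx i 0 : 'cV[R]_r)) 0 0 = - t 0 i.
  by rewrite mulmxN mxE -colE mxE.
have E2 (t : 'rV[R]_r) : (t *m (const_mx 1 : 'cV_r)) 0 0 = \sum_i t 0 i.
  by rewrite mxE; apply: eq_bigr => i _; rewrite mxE mulr1.
apply/seteqP; split => t /=; rewrite /std_simplex /= E2 => -[h1 h2]; split => // i.
  by rewrite E1 oppr_le0.
by rewrite -oppr_le0 -E1.
Qed.

(** The standard simplex is the pyramid over the standard simplex in one dimension
    less.  This is why normalising by its measure turns the formula for the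
    volume of a pyramid into base times height. *)
Lemma leb_std_simplexS r :
  leb R r.+1 (@std_simplex r.+1) = (pyramid_factor r * leb R r (@std_simplex r))%E.
Proof.
have sumE x (y : 'rV[R]_r) : \sum_i cons_rV (x, y) 0 i = x + \sum_i y 0 i.
  rewrite big_ord_recl cons_rV0; congr (_ + _).
  by apply: eq_bigr => i _; rewrite cons_rVS.
apply: leb_pyramid; try exact: measurable_std_simplex.
- move=> x y [h0]; rewrite sumE => h1.
  have := h0 0; rewrite cons_rV0 => x0; rewrite x0 /=.
  apply: le_trans h1; rewrite lerDl sumr_ge0// => i _.
  by have := h0 (lift ord0 i); rewrite cons_rVS.
- move=> x y /andP[x0 x1]; rewrite /std_simplex /= sumE.
  have sE : \sum_i ((1 - x)^-1 *: y) 0 i = (1 - x)^-1 * \sum_i y 0 i.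
    by rewrite mulr_sumr; apply: eq_bigr => i _; rewrite mxE.
  have x1' : 0 < 1 - x by rewrite subr_gt0.
  rewrite sE ler_pdivrMl// mulr1 lerBrDl; split => -[h0 h1]; split => // i.
    rewrite mxE mulr_ge0 ?invr_ge0 ?(ltW x1')//.
    by have := h0 (lift ord0 i); rewrite cons_rVS.
  case: (unliftP ord0 i) => [j|] ->; rewrite ?cons_rVS ?cons_rV0//.
  by have := h0 j; rewrite mxE pmulr_rge0// invr_gt0.
Qed.

Lemma leb_std_simplex_gt0 r : (0 < leb R r (@std_simplex r) < +oo)%E.
Proof.
elim: r => [|r /andP[IH1 IH2]].
  rewrite lebE /= indicE mem_set ?ltry ?lte_fin ?ltr01//.
  by split; [case|rewrite big_ord0 ler01].
rewrite leb_std_simplexS mule_gt0 ?pyramid_factor_gt0//=.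
apply: lte_mul_pinfty => //; first exact/ltW/pyramid_factor_gt0.
by rewrite ge0_fin_numE ?pyramid_factor_lty// ltW// pyramid_factor_gt0.
Qed.

End RowMeasure.

(** * Linear forms and Farkas' lemma *)

Section LinearForms.
Variables (R : realType) (n : nat).
Implicit Types (c f g : 'cV[R]_n) (x y : 'rV[R]_n).

(** Linear forms are represented by columns, so that they form a vector space in
    which subspaces can be separated from points by matrix algebra. *)
Definition ev c x : R := (x *m c) 0 0.

Fact ev_is_linear c : linear_for *%R (ev c).
Proof. by move=> k x y; rewrite /ev mulmxDl -scalemxAl mxE [X in X + _]mxE. Qed.
HB.instance Definition _ c := GRing.isLinear.Build R 'rV[R]_n R *%R (ev c) (ev_is_linear c).

Lemma evZ c k x : ev c (k *: x) = k * ev c x.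
Proof. by rewrite /ev -scalemxAl mxE. Qed.

Lemma evB c x y : ev c (x - y) = ev c x - ev c y.
Proof. exact: raddfB. Qed.

Lemma evD c x y : ev c (x + y) = ev c x + ev c y.
Proof. exact: raddfD. Qed.

Lemma ev_formD c f x : ev (c + f) x = ev c x + ev f x.
Proof. by rewrite /ev mulmxDr mxE. Qed.

Lemma ev_formN c x : ev (- c) x = - ev c x.
Proof. by rewrite /ev mulmxN mxE. Qed.

Lemma ev_formZ k c x : ev (k *: c) x = k * ev c x.
Proof. by rewrite /ev -scalemxAr mxE. Qed.

Definition form_col (l : {scalar 'rV[R]_n}) : 'cV[R]_n := \col_i l (delta_mx 0 i).

Lemma ev_form_col (l : {scalar 'rV[R]_n}) x : ev (form_col l) x = l x.
Proof.
rewrite [in RHS](row_sum_delta x) linear_sum /ev mxE.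
by apply: eq_bigr => i _; rewrite linearZ mxE.
Qed.

(** The cone spanned by a list, defined by recursion on the list to match the
    induction in Farkas' lemma. *)
Fixpoint conic (s : seq 'rV[R]_n) (b : 'rV[R]_n) : Prop :=
  if s is a :: s' then exists2 k, 0 <= k & conic s' (b - k *: a) else b = 0.

(** Undoes the projection along [a0] in the induction step of [farkas_conic]: as the
    subtracted multiples of [a0] have coefficients [g a <= 0], restoring them
    contributes a nonnegative multiple of [a0]. *)
Lemma conic_unshear (s : seq 'rV[R]_n) (g : 'rV[R]_n -> R) a0 b :
  (forall a, a \in s -> g a <= 0) ->
  conic [seq a - g a *: a0 | a <- s] b -> exists2 k, 0 <= k & conic s (b - k *: a0).
Proof.
elim: s b => [|a s IH] b gs /=; first by move=> ->; exists 0; rewrite // scale0r subr0.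
case=> l l0 /IH[|k k0 hk]; first by move=> a' a's; apply: gs; rewrite inE a's orbT.
have ga : g a <= 0 by apply: gs; rewrite mem_head.
exists (k - l * g a); first by rewrite subr_ge0 (le_trans _ k0)// mulr_ge0_le0.
exists l => //; move: hk; congr (conic s _).
by rewrite scalerBr scalerBl scalerA opprB !opprD opprK; apply/rowP => i; rewrite !mxE; ring.
Qed.

(** Farkas' lemma, by Bartl's induction on the number of generators.  If the first
    generator [a0] is needed, some [x] is nonpositive on the other generators
    but positive at [b] and hence at [a0].  Projecting along [a0] onto the kernel
    of [x] preserves the hypothesis and removes [a0]. *)
Lemma farkas_conic (s : seq 'rV[R]_n) b :
  (forall c, (forall a, a \in s -> ev c a <= 0) -> ev c b <= 0) -> conic s b.
Proof.
have [k] := ubnP (size s); elim: k s b => // k IH [|a0 s] b /=.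
  move=> _ h; apply/rowP => i; rewrite mxE.
  have E (e : R) : ev (e *: delta_mx i 0) b = e * b 0 i.
    by rewrite ev_formZ /ev -colE mxE.
  have h1 : b 0 i <= 0 by have := h (1 *: delta_mx i 0); rewrite E mul1r; apply.
  have h2 : - b 0 i <= 0 by have := h (-1 *: delta_mx i 0); rewrite E mulN1r; apply.
  by apply/eqP; rewrite eq_le h1 -oppr_le0.
rewrite ltnS => sk h.
have [hs|] := pselect (forall c, (forall a, a \in s -> ev c a <= 0) -> ev c b <= 0).
  by exists 0 => //; rewrite scale0r subr0; exact: IH.
move=> /existsNP[x /not_implyP[xs /negP]]; rewrite -ltNge => xb.
have xa0 : 0 < ev x a0.
  rewrite ltNge; apply/negP => xa0; have := h x; rewrite leNgt xb => /(_ _)/negP; apply => //.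
  by move=> a; rewrite inE => /orP[/eqP->//|]; exact: xs.
pose x1 := (ev x a0)^-1 *: x.
have x1a0 : ev x1 a0 = 1 by rewrite ev_formZ mulVf// gt_eqF.
have x1s a : a \in s -> ev x1 a <= 0.
  by move=> /xs ha; rewrite ev_formZ mulr_ge0_le0// invr_ge0 ltW.
have x1b : 0 < ev x1 b by rewrite ev_formZ mulr_gt0// invr_gt0.
have : conic [seq a - ev x1 a *: a0 | a <- s] (b - ev x1 b *: a0).
  apply: IH; first by rewrite size_map.
  move=> c hc; pose c' := c - ev c a0 *: x1.
  have E a : ev c' a = ev c (a - ev x1 a *: a0).
    by rewrite ev_formD ev_formN ev_formZ evB evZ mulrC.
  rewrite -E; apply: h => a; rewrite inE E => /orP[/eqP->|as_].
    by rewrite x1a0 scale1r subrr raddf0.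
  by apply: hc; exact: map_f.
case/(conic_unshear x1s) => l l0 hl; exists (ev x1 b + l); first by rewrite addr_ge0// ltW.
by move: hl; congr (conic s _); rewrite scalerDl opprD addrA.
Qed.

End LinearForms.

(** * Polytopes as sections of cones *)

Section Polytope.
Variables (R : realType) (n m : nat) (p : 'I_m -> 'rV[R]_n) (d : 'cV[R]_n).
Hypothesis dp : forall i, ev d (p i) = 1.
Implicit Types (I J : {set 'I_m}) (f g : 'cV[R]_n) (x y v : 'rV[R]_n).

(** The points [p i] all lie on the hyperplane [ev d x = 1], so that the polytope
    spanned by some of them is a hyperplane section of the cone they span.
    Affine inequalities on the polytope become homogeneous ones on the cone, and
    a face is described by the set of indices of the points that it contains. *)
Definition pcone I : set 'rV[R]_n :=
  [set x | exists c : 'I_m -> R,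
    [/\ forall i, 0 <= c i, forall i, i \notin I -> c i = 0
      & x = \sum_i c i *: p i]].

Definition polytope I : set 'rV[R]_n := pcone I `&` [set x | ev d x = 1].

Definition nonpos I f := forall i, i \in I -> ev f (p i) <= 0.

Definition tight I f : {set 'I_m} := [set i in I | ev f (p i) == 0].

(** Rows outside [I] are zero, which avoids reindexing by the elements of [I]. *)
Definition spanmx I : 'M[R]_(m, n) := \matrix_i (if i \in I then p i else 0).

Lemma ev_sum f (c : 'I_m -> R) : ev f (\sum_i c i *: p i) = \sum_i c i * ev f (p i).
Proof. by rewrite linear_sum; apply: eq_bigr => i _; exact: evZ. Qed.

Lemma mem_pcone I i : i \in I -> pcone I (p i).
Proof.
move=> iI; exists (fun j => (j == i)%:R); split => [j|j jI|].
- by rewrite ler0n.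
- by case: eqP jI => // ->; rewrite iI.
- rewrite (bigD1 i)//= eqxx scale1r big1 ?addr0// => j /negbTE->.
  by rewrite scale0r.
Qed.

Lemma mem_poly I i : i \in I -> polytope I (p i).
Proof. by move=> iI; split; [exact: mem_pcone|exact: dp]. Qed.

Lemma pconeD I x y : pcone I x -> pcone I y -> pcone I (x + y).
Proof.
move=> [a [a0 aI ->]] [b [b0 bI ->]]; exists (fun i => a i + b i); split => [i|i iI|].
- by rewrite addr_ge0.
- by rewrite aI// bI// addr0.
- by rewrite -big_split; apply: eq_bigr => i _; rewrite scalerDl.
Qed.

Lemma pconeZ I k x : 0 <= k -> pcone I x -> pcone I (k *: x).
Proof.
move=> k0 [a [a0 aI ->]]; exists (fun i => k * a i); split => [i|i iI|].
- by rewrite mulr_ge0.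
- by rewrite aI// mulr0.
- by rewrite scaler_sumr; apply: eq_bigr => i _; rewrite scalerA.
Qed.

Lemma pcone_sub I J : I \subset J -> pcone I `<=` pcone J.
Proof.
move=> IJ x [a [a0 aI ->]]; exists a; split => // i iJ; apply: aI.
by apply: contra iJ; exact: (fintype.subsetP IJ).
Qed.

Lemma poly_sub I J : I \subset J -> polytope I `<=` polytope J.
Proof. by move=> IJ x [h1 h2]; split => //; exact: pcone_sub h1. Qed.

Lemma pcone_nonpos I f x : nonpos I f -> pcone I x -> ev f x <= 0.
Proof.
move=> fI [a [a0 aI ->]]; rewrite ev_sum sumr_le0// => i _.
have [iI|iI] := boolP (i \in I); last by rewrite aI// mul0r.
by rewrite mulr_ge0_le0// fI.
Qed.

(** In a sum of nonpositive terms that vanishes, every term vanishes. *)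
Lemma pcone_tight I f x : nonpos I f -> pcone I x -> ev f x = 0 -> pcone (tight I f) x.
Proof.
move=> fI [a [a0 aI ->]]; rewrite ev_sum => s0; exists a; split => // i.
rewrite inE negb_and => /orP[/aI//|fi].
have : \sum_i - (a i * ev f (p i)) = 0 by rewrite sumrN s0 oppr0.
move=> /psumr_eq0P h.
have : - (a i * ev f (p i)) = 0.
  apply: h => // j _; rewrite oppr_ge0.
  have [jI|jI] := boolP (j \in I); last by rewrite aI// mul0r.
  by rewrite mulr_ge0_le0// fI.
by move/eqP; rewrite oppr_eq0 mulf_eq0 (negbTE fi) orbF => /eqP.
Qed.

Lemma tight_eq0 I f x : pcone (tight I f) x -> ev f x = 0.
Proof.
move=> [a [a0 aI ->]]; rewrite ev_sum big1// => i _.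
have [|/aI->] := boolP (i \in tight I f); last by rewrite mul0r.
by rewrite inE => /andP[_ /eqP->]; rewrite mulr0.
Qed.

Lemma poly_tightE I f : nonpos I f -> polytope (tight I f) = polytope I `&` [set x | ev f x = 0].
Proof.
move=> fI; apply/seteqP; split => x /=.
  move=> [xT x1]; split; last exact: tight_eq0 xT.
  by split => //; apply: pcone_sub xT; apply/fintype.subsetP => i; rewrite inE => /andP[].
by move=> [[xI x1] fx]; split => //; exact: pcone_tight.
Qed.

Lemma pcone_delta0 I x : pcone I x -> ev d x = 0 -> x = 0.
Proof.
move=> [a [a0 aI ->]]; rewrite ev_sum => /psumr_eq0P h.
rewrite big1// => i _.
have : a i * ev d (p i) = 0 by apply: h => // j _; rewrite dp mulr1.
by rewrite dp mulr1 => ->; rewrite scale0r.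
Qed.

Lemma pcone_farkas I x : ~ pcone I x -> exists2 f, nonpos I f & 0 < ev f x.
Proof.
move=> xI; apply: contrapT => h; apply: xI.
have : conic [seq p i | i <- enum I] x.
  apply: farkas_conic => c hc; rewrite leNgt; apply/negP => cx; apply: h.
  by exists c => // i iI; apply: hc; apply: map_f; rewrite mem_enum.
have : {subset enum I <= I} by move=> i; rewrite mem_enum.
move: (enum I) => s; elim: s x {h} => [|i s IH] x /= sI.
  by move=> ->; exists (fun=> 0); split => //; rewrite big1// => i _; rewrite scale0r.
case=> k k0 /IH h.
have xE : x = (x - k *: p i) + k *: p i by rewrite subrK.
rewrite xE; apply: pconeD; first by apply: h => j js; apply: sI; rewrite inE js orbT.
by apply: pconeZ => //; apply: mem_pcone; apply: sI; rewrite mem_head.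
Qed.

Lemma mem_span I i : i \in I -> (p i <= spanmx I)%MS.
Proof.
move=> iI; have := row_sub i (spanmx I).
by rewrite rowK iI.
Qed.

Lemma pcone_span I x : pcone I x -> (x <= spanmx I)%MS.
Proof.
move=> [a [a0 aI ->]]; apply: summx_sub => i _.
have [iI|/aI->] := boolP (i \in I); last by rewrite scale0r sub0mx.
by apply: scalemx_sub; exact: mem_span.
Qed.

Lemma span_ev0 I f x : (forall i, i \in I -> ev f (p i) = 0) ->
  (x <= spanmx I)%MS -> ev f x = 0.
Proof.
move=> fI /submxP[a ->]; rewrite /ev -mulmxA (_ : spanmx I *m f = 0) ?mulmx0 ?mxE//.
apply/row_matrixP => i; rewrite row_mul rowK row0; apply/rowP => j; rewrite ord1 [RHS]mxE.
by case: ifPn => [/fI//|_]; rewrite mul0mx mxE.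
Qed.

Lemma span_ev_neq0 I f x : (x <= spanmx I)%MS -> ev f x != 0 ->
  exists2 i, i \in I & ev f (p i) != 0.
Proof.
move=> xI fx; apply: contrapT => h; move/eqP: fx; apply; apply: span_ev0 xI => i iI.
by apply: contrapT => /eqP fi; apply: h; exists i.
Qed.

(** A point outside a row space is detected by the cokernel of the matrix. *)
Lemma separate_from_span k (A : 'M[R]_(k, n)) y :
  ~~ (y <= A)%MS -> exists2 g, A *m g = 0 & ev g y != 0.
Proof.
rewrite submxE => /matrix0Pn[i [j h]].
exists (col j (cokermx A)).
  by rewrite colE mulmxA mulmx_coker mul0mx.
by rewrite /ev colE mulmxA -colE mxE -(ord1 i).
Qed.

(** Tilts the supporting hyperplane of [f] about the points where it is tight.  A form
    [g] that vanishes at these points and at [x0] but not at [y] exists, because a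
    point of span(tight points, [x0]) where [f] vanishes lies in the span of the
    tight points.  Moving from [f] in the direction [g] until a new point becomes
    tight keeps the value at [x0]. *)
Lemma tilt_form I f x0 y : nonpos I f -> ev f x0 != 0 ->
  (y <= spanmx I)%MS -> ev f y = 0 -> ~~ (y <= spanmx (tight I f))%MS ->
  exists f', [/\ nonpos I f', ev f' x0 = ev f x0 & tight I f \proper tight I f'].
Proof.
move=> fI fx0 yI fy yT.
have : ~~ (y <= spanmx (tight I f) + x0)%MS.
  apply: contra yT => /sub_addsmxP[[u1 u2] /= yE].
  move: (fy); rewrite yE raddfD /= (@span_ev0 (tight I f) f (u1 *m _)); last 2 first.
  - by move=> i; rewrite inE => /andP[_ /eqP].
  - exact: submxMl.
  rewrite add0r [u2]mx11_scalar mul_scalar_mx evZ => /eqP; rewrite mulf_eq0 (negbTE fx0) orbF.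
  by move=> /eqP->; rewrite scale0r addr0 submxMl.
move=> /separate_from_span[g0 gA gy0].
have [g0T g0x0] : (forall i, i \in tight I f -> ev g0 (p i) = 0) /\ ev g0 x0 = 0.
  have gsub (z : 'rV[R]_n) : (z <= spanmx (tight I f) + x0)%MS -> ev g0 z = 0.
    by move=> /submxP[a ->]; rewrite /ev -mulmxA gA mulmx0 mxE.
  split => [i iT|]; apply: gsub; last exact: addsmxSr.
  by apply: submx_trans (mem_span iT) _; exact: addsmxSl.
have [i0 i0I g0i] := span_ev_neq0 yI gy0.
have [g [gT gx0 gi]] : exists g, [/\ forall i, i \in tight I f -> ev g (p i) = 0,
    ev g x0 = 0 & 0 < ev g (p i0)].
  have [gpos|gneg] := ltP 0 (ev g0 (p i0)); first by exists g0.
  exists (- g0); rewrite !ev_formN g0x0 oppr0; split => // [i /g0T|].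
    by rewrite ev_formN => ->; rewrite oppr0.
  by rewrite oppr_gt0 lt_neqAle g0i.
pose q i := - ev f (p i) / ev g (p i).
pose P i := (i \in I) && (0 < ev g (p i)).
have Pi0 : P i0 by rewrite /P i0I.
have [/= k /andP[kI gk] kmin] := arg_minP q Pi0.
have f_lt i : P i -> ev f (p i) < 0.
  move=> /andP[iI gi']; rewrite lt_neqAle fI// andbT; apply: contraTneq gi' => fi.
  by rewrite gT ?ltxx// inE iI fi eqxx.
have qk : 0 < q k by rewrite divr_gt0// oppr_gt0 f_lt// /P kI.
exists (f + q k *: g); split.
- move=> i iI; rewrite ev_formD ev_formZ.
  have [gi'|gi'] := ltP 0 (ev g (p i)).
    have := kmin i; rewrite /P iI gi' => /(_ isT).
    by rewrite {2}/q ler_pdivlMr// => h; rewrite -lerBrDl sub0r.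
  apply: le_trans (fI i iI); rewrite gerDl mulr_ge0_le0//; exact: ltW.
- by rewrite ev_formD ev_formZ gx0 mulr0 addr0.
- apply/properP; split.
    apply/fintype.subsetP => i iT; move: (iT); rewrite !inE => /andP[iI /eqP fi].
    by rewrite iI ev_formD ev_formZ fi gT// mulr0 addr0 eqxx.
  exists k; rewrite !inE kI /= ?ev_formD ?ev_formZ.
    by rewrite /q divfK ?(gt_eqF gk)// addrN.
  by rewrite lt_eqF// f_lt// /P kI.
Qed.

(** The last condition says that the face where [f] vanishes has codimension 1. *)
Definition facet_form I f := [/\ nonpos I f, exists2 i, i \in I & ev f (p i) != 0
  & forall y, (y <= spanmx I)%MS -> ev f y = 0 -> (y <= spanmx (tight I f))%MS].

(** Each tilt enlarges the set of tight points, so tilting stops, and it stops only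
    at codimension 1. *)
Lemma exists_facet_form I f x0 : nonpos I f -> (x0 <= spanmx I)%MS -> ev f x0 != 0 ->
  exists f', [/\ facet_form I f', ev f' x0 = ev f x0 & tight I f \subset tight I f'].
Proof.
have [k] := ubnP (#|I| - #|tight I f|); elim: k f => // k IH f.
rewrite ltnS => fk fI x0I fx0.
have [h|] := pselect (forall y, (y <= spanmx I)%MS -> ev f y = 0 -> (y <= spanmx (tight I f))%MS).
  by exists f; split => //; split => //; exact: span_ev_neq0 fx0.
move=> /existsNP[y /not_implyP[yI /not_implyP[fy /negP yT]]].
have [f' [f'I f'x0 ff']] := tilt_form fI fx0 yI fy yT.
have lt_k : (#|I| - #|tight I f'| < k)%N.
  apply: leq_trans fk; apply: ltn_sub2l; last exact: proper_card.
  have : tight I f' \subset I by apply/fintype.subsetP => i; rewrite inE => /andP[].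
  by move=> /subset_leq_card; apply: leq_trans; exact: proper_card.
have f'x00 : ev f' x0 != 0 by rewrite f'x0.
have [f'' [h1 h2 h3]] := IH f' lt_k f'I x0I f'x00.
exists f''; split => //; first by rewrite h2.
by apply: fintype.subset_trans h3; exact: proper_sub.
Qed.

Lemma outside_facet_form I x : (x <= spanmx I)%MS -> ~ pcone I x ->
  exists2 f, facet_form I f & 0 < ev f x.
Proof.
move=> xI /pcone_farkas[f fI fx].
have [|f' [h1 h2 _]] := exists_facet_form fI xI; first by rewrite gt_eqF.
by exists f' => //; rewrite h2.
Qed.

(** Two forms that define the same facet agree on the span up to a factor, as both
    vanish exactly on the same hyperplane of it. *)
Lemma facet_form_proportional I f f' x v : facet_form I f -> facet_form I f' ->
  tight I f = tight I f' -> (x <= spanmx I)%MS -> (v <= spanmx I)%MS ->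
  ev f x * ev f' v = ev f' x * ev f v.
Proof.
move=> [_ _ fT] [_ _ f'T] TT xI vI.
pose y := ev f v *: x - ev f x *: v.
have yI : (y <= spanmx I)%MS by rewrite addmx_sub ?scalemx_sub// eqmx_opp scalemx_sub.
have fy : ev f y = 0 by rewrite evB !evZ mulrC subrr.
have := fT y yI fy; rewrite TT => /span_ev0 h.
have : ev f' y = 0 by apply: h => i; rewrite inE => /andP[_ /eqP].
by rewrite evB !evZ => /eqP; rewrite subr_eq0 => /eqP <-; rewrite mulrC.
Qed.

End Polytope.

(** * Faces and facets *)

Section Facets.
Variables (R : realType) (n m : nat) (p : 'I_m -> 'rV[R]_n) (d : 'cV[R]_n).
Hypothesis dp : forall i, ev d (p i) = 1.
Implicit Types (I J : {set 'I_m}) (f g : 'cV[R]_n) (x y v : 'rV[R]_n).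
Notation polytope := (polytope p d).
Notation pcone := (pcone p).
Notation tight := (tight p).
Notation spanmx := (spanmx p).
Notation facet_form := (facet_form p).
Notation nonpos := (nonpos p).

Lemma tight_sub I f : tight I f \subset I.
Proof. by apply/fintype.subsetP => i; rewrite inE => /andP[]. Qed.

Lemma poly_tight_inj I f f' : nonpos I f -> nonpos I f' ->
  polytope (tight I f) `<=` polytope (tight I f') -> tight I f \subset tight I f'.
Proof.
move=> fI f'I h; apply/fintype.subsetP => i iT.
have /h : polytope (tight I f) (p i) by exact: mem_poly.
move: iT; rewrite poly_tightE// !inE => /andP[-> _] [_ /= ->].
by rewrite eqxx.
Qed.

Lemma tight_face I f : nonpos I f -> face (polytope I) (polytope (tight I f)).
Proof.
move=> fI; exists (ev f : {scalar 'rV[R]_n}), 0; split; last exact: poly_tightE.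
by move=> x [xI _]; exact: pcone_nonpos fI xI.
Qed.

(** As [d] is constant on the polytope, the constant in the affine inequality that
    defines a face can be absorbed into the linear form. *)
Lemma face_tight I G : face (polytope I) G -> exists2 f, nonpos I f & G = polytope (tight I f).
Proof.
move=> [l [c [lc ->]]]; pose f := form_col l - c *: d.
have fE x : ev f x = l x - c * ev d x by rewrite ev_formD ev_formN ev_formZ ev_form_col.
have fI : nonpos I f.
  by move=> i iI; rewrite fE dp mulr1 subr_le0; apply: lc; exact: mem_poly.
exists f => //; rewrite poly_tightE//; apply/seteqP; split => x /= [[xI x1] h]; split => //.
  by rewrite fE x1 mulr1 h subrr.
by move/eqP: h; rewrite fE x1 mulr1 subr_eq0 => /eqP.
Qed.

(** A larger face would be given by a form vanishing on a hyperplane of the span and at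
    one further point, hence everywhere. *)
Lemma facet_form_facet I f : facet_form I f -> facet (polytope I) (polytope (tight I f)).
Proof.
move=> [fI [i0 i0I fi0] fT]; split.
- exact: tight_face.
- move=> E; have : polytope (tight I f) (p i0) by rewrite E; exact: mem_poly.
  by rewrite poly_tightE// => -[_ /= /eqP]; rewrite (negbTE fi0).
move=> G' /face_tight[f' f'I ->] G'F TT; congr polytope; apply/eqP; rewrite finset.eqEsubset andbC.
have sTT := poly_tight_inj fI f'I TT; rewrite sTT /=.
apply/fintype.subsetP => i iT'; rewrite inE.
move: (iT'); rewrite inE => /andP[iI /eqP f'i]; rewrite iI /=; apply: contrapT => /negP fi.
apply: G'F; congr polytope; apply/eqP; rewrite finset.eqEsubset tight_sub /=; apply/fintype.subsetP => j jI.
rewrite inE jI /=.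
pose y := ev f (p i) *: p j - ev f (p j) *: p i.
have yI : (y <= spanmx I)%MS by rewrite addmx_sub ?eqmx_opp// scalemx_sub// mem_span.
have /(fT _ yI) yT : ev f y = 0 by rewrite evB !evZ mulrC subrr.
have : ev f' y = 0.
  apply: span_ev0 yT => k kT; move/fintype.subsetP: sTT => /(_ k kT).
  by rewrite inE => /andP[_ /eqP].
by rewrite evB !evZ f'i mulr0 subr0 => /eqP; rewrite mulf_eq0 (negbTE fi).
Qed.

(** A form that defines the facet can be tilted to codimension 1 without losing a tight
    point or becoming zero; by maximality this defines the same face. *)
Lemma facet_has_form I G : facet (polytope I) G ->
  exists2 f, facet_form I f & G = polytope (tight I f).
Proof.
move=> [/face_tight[f fI ->] GF Gmax].
have [i iI fi] : exists2 i, i \in I & ev f (p i) != 0.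
  apply: contrapT => h; apply: GF; congr polytope; apply/eqP; rewrite finset.eqEsubset tight_sub /=.
  apply/fintype.subsetP => i iI; rewrite inE iI /=; apply: contrapT => /negP fi; apply: h.
  by exists i.
have [f' [f'F f'i TT]] := exists_facet_form fI (mem_span p iI) fi.
have [f'I _ _] := f'F.
exists f' => //; symmetry; apply: Gmax; first exact: tight_face.
- move=> E; have : polytope (tight I f') (p i) by rewrite E; exact: mem_poly.
  by rewrite poly_tightE// => -[_ /= /eqP]; rewrite f'i (negbTE fi).
- exact: poly_sub.
Qed.

(** * Decomposition into pyramids with a common apex *)

Section Apex.
Variables (I : {set 'I_m}) (v : 'rV[R]_n).
Hypothesis vI : polytope I v.

(** Facets are indexed by the set of the points they contain: this is a finite type,
    and it makes finite sums and measurable intersections over facets available. *)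
Definition facet_index : {set {set 'I_m}} :=
  [set J : {set 'I_m} | `[< exists2 f, facet_form I f & J = tight I f >]].

Definition facet_col (J : {set 'I_m}) : 'cV[R]_n :=
  xget 0 [set f | facet_form I f /\ J = tight I f].

Lemma facet_colP J : J \in facet_index -> facet_form I (facet_col J) /\ J = tight I (facet_col J).
Proof.
rewrite inE => /asboolP[f h1 h2]; rewrite /facet_col.
by case: xgetP => [f' -> //|/(_ f)]; case.
Qed.

Lemma tight_facet_index f : facet_form I f -> tight I f \in facet_index.
Proof. by move=> h; rewrite inE; apply/asboolP; exists f. Qed.

Lemma facet_col_nonpos J x : J \in facet_index -> polytope I x -> ev (facet_col J) x <= 0.
Proof. by move=> /facet_colP[[fI _ _] _] [xI _]; exact: pcone_nonpos fI xI. Qed.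

Lemma apex_span : (v <= spanmx I)%MS.
Proof. by case: vI => h _; exact: pcone_span h. Qed.

Definition opp_index : {set {set 'I_m}} :=
  [set J in facet_index | ev (facet_col J) v < 0].

Lemma opp_indexP J : J \in opp_index -> J \in facet_index /\ ev (facet_col J) v < 0.
Proof. by rewrite inE => /andP[]. Qed.

(** For [x] in the pyramid with apex [v] over the facet [J], this is the coefficient of
    the apex when [x] is written as a convex combination of [v] and a point of the
    base. *)
Definition rel_height (J : {set 'I_m}) x : R := ev (facet_col J) x / ev (facet_col J) v.

(** The relative height does not depend on the form chosen for the facet, since forms of
    the same facet are proportional. *)
Lemma rel_height_form f x : facet_form I f -> ev f v < 0 -> (x <= spanmx I)%MS ->
  tight I f \in opp_index /\ rel_height (tight I f) x = ev f x / ev f v.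
Proof.
move=> fF fv xI; have TF := tight_facet_index fF.
have [gF gT] := facet_colP TF.
have E z := @facet_form_proportional _ _ _ p I f (facet_col (tight I f)) z v fF gF gT.
have [gI [i iI gi] _] := gF.
have gi' : ev (facet_col (tight I f)) (p i) < 0 by rewrite lt_neqAle gi gI.
have gv : ev (facet_col (tight I f)) v < 0.
  have := @facet_form_proportional _ _ _ p I f (facet_col (tight I f)) v (p i) fF gF gT apex_span (mem_span p iI).
  have fi : ev f (p i) <= 0 by case: fF => fI _ _; exact: fI.
  have := facet_col_nonpos TF vI; rewrite le_eqVlt => /orP[/eqP->|//].
  rewrite mul0r => /eqP; rewrite mulf_eq0 (negbTE gi) orbF => /eqP fv0.
  by move: fv; rewrite fv0 ltxx.
split; first by rewrite inE TF.
have := E x xI apex_span; rewrite /rel_height => h.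
by apply/eqP; rewrite eqr_div ?(lt_eqF fv) ?(lt_eqF gv)// h.
Qed.

Lemma rel_height_apex J : J \in opp_index -> rel_height J v = 1.
Proof. by move=> /opp_indexP[_ h]; rewrite /rel_height divff// lt_eqF. Qed.

Lemma rel_height_ge0 J x : J \in opp_index -> polytope I x -> 0 <= rel_height J x.
Proof.
move=> /opp_indexP[JF h] xI; rewrite /rel_height mulr_le0//; first exact: facet_col_nonpos.
by rewrite invr_le0 ltW.
Qed.

Lemma rel_heightD J x y : rel_height J (x + y) = rel_height J x + rel_height J y.
Proof. by rewrite /rel_height evD mulrDl. Qed.

Lemma rel_heightZ J k x : rel_height J (k *: x) = k * rel_height J x.
Proof. by rewrite /rel_height evZ mulrA. Qed.

Lemma rel_heightB J x y : rel_height J (x - y) = rel_height J x - rel_height J y.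
Proof. by rewrite /rel_height evB mulrBl. Qed.

Lemma opposite_facetsE : opposite_facets (polytope I) v = polytope @` [set` opp_index].
Proof.
apply/seteqP; split => G /=.
  move=> [/facet_has_form[f fF ->] Gv]; exists (tight I f) => //.
  have [fI _ _] := fF.
  have fv : ev f v < 0.
    rewrite lt_neqAle; have [vI' v1] := vI; rewrite (pcone_nonpos fI vI') andbT.
    by apply/negP => /eqP fv; apply: Gv; rewrite poly_tightE.
  by have [] := rel_height_form fF fv apex_span.
move=> [J /opp_indexP[/facet_colP[fF JT] fv] <-]; split.
  by rewrite JT; exact: facet_form_facet.
have [fI _ _] := fF.
by rewrite JT poly_tightE// => -[_ /= h]; move: fv; rewrite h ltxx.
Qed.

Lemma poly_opp_inj : {in opp_index &, injective polytope}.
Proof.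
move=> J J' /opp_indexP[/facet_colP[[fI _ _] JT] _] /opp_indexP[/facet_colP[[f'I _ _] J'T] _].
move=> E; rewrite JT J'T; apply/eqP; rewrite finset.eqEsubset; apply/andP; split; apply: poly_tight_inj => //;
  by rewrite -JT -J'T E.
Qed.

(** A direction that no facet blocks lies in the cone; and the only point of the cone
    where [d] vanishes is the origin. *)
Lemma no_recession u : (u <= spanmx I)%MS -> ev d u = 0 ->
  (forall f, facet_form I f -> ev f u <= 0) -> u = 0.
Proof.
move=> uI u0 h; apply: contrapT => un.
have : ~ pcone I u by move=> uc; apply: un; exact: (pcone_delta0 dp uc).
by move=> /(outside_facet_form uI)[f /h]; rewrite leNgt => /negP.
Qed.

Lemma poly_halfspaces x : (x <= spanmx I)%MS -> ev d x = 1 ->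
  polytope I x <-> forall J, J \in facet_index -> ev (facet_col J) x <= 0.
Proof.
move=> xI x1; split=> [xF J JF|h]; first exact: facet_col_nonpos.
split => //; apply: contrapT => /(outside_facet_form xI)[f fF fx].
have TF := tight_facet_index fF; have [gF gT] := facet_colP TF.
have [fI [i iI fi] _] := fF.
have := facet_form_proportional fF gF gT xI (mem_span p iI).
have fi' : ev f (p i) < 0 by rewrite lt_neqAle fi fI.
have gi : ev (facet_col (tight I f)) (p i) < 0.
  rewrite lt_neqAle; have [gI _ _] := gF; rewrite gI// andbT.
  apply: contra fi => gi; have : i \in tight I f by rewrite gT inE iI.
  by rewrite inE => /andP[].
have := h _ TF => gx E.
have : ev f x * ev (facet_col (tight I f)) (p i) < 0 by rewrite pmulr_rlt0.
by rewrite E ltNge mulr_le0// ltW.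
Qed.

(** The pyramid with apex [v] over the facet [J], described by inequalities: a ray from
    [v] leaves the polytope through the facet whose relative height decreases
    fastest along it. *)
Definition piece (J : {set 'I_m}) : set 'rV[R]_n :=
  [set x | polytope I x /\ forall J', J' \in opp_index -> rel_height J x <= rel_height J' x].

Lemma piece_le1 J x : J \in opp_index -> piece J x -> rel_height J x <= 1.
Proof.
move=> JO [[xI x1] xm]; rewrite leNgt; apply/negP => x_gt1.
have [vc v1] := vI.
suff /eqP : x - v = 0.
  by rewrite subr_eq0 => /eqP xv; move: x_gt1; rewrite xv rel_height_apex ?ltxx.
apply: no_recession.
- by rewrite addmx_sub ?eqmx_opp ?apex_span// (pcone_span xI).
- by rewrite evB x1 v1 subrr.
move=> f fF; have [fI _ _] := fF.
have : ev f v <= 0 by exact: pcone_nonpos fI vc.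
rewrite le_eqVlt evB => /orP[/eqP->|fv]; first by rewrite subr0 (pcone_nonpos fI xI).
have [TO] := rel_height_form fF fv (pcone_span xI).
have /(lt_le_trans x_gt1) := xm _ TO => + E; rewrite E.
by rewrite ltr_ndivlMr// mul1r subr_le0 => /ltW.
Qed.

(** Identifies the piece with a pyramid, away from the apex: projecting [x] from [v] onto
    the hyperplane of the facet gives a point which lies in the polytope precisely if
    no other relative height vanishes earlier on the ray. *)
Lemma pieceE J x : J \in opp_index -> (x <= spanmx I)%MS -> ev d x = 1 ->
  0 <= rel_height J x < 1 ->
  piece J x <-> polytope J (v + (1 - rel_height J x)^-1 *: (x - v)).
Proof.
move=> JO xI x1 /andP[s0 s1].
set s := rel_height J x; pose g := v + (1 - s)^-1 *: (x - v).
have s1' : 0 < 1 - s by rewrite subr_gt0.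
have [JF fv] := opp_indexP JO; have [fF JT] := facet_colP JF.
have [fI _ _] := fF; have [vc v1] := vI.
have gE J' : rel_height J' g = rel_height J' v + (1 - s)^-1 * (rel_height J' x - rel_height J' v).
  by rewrite rel_heightD rel_heightZ rel_heightB.
have gJ : ev (facet_col J) g = 0.
  have : rel_height J g = 0.
    by rewrite gE rel_height_apex// -/s -[s - 1]opprB mulrN mulVf ?gt_eqF// subrr.
  by move/eqP; rewrite mulf_eq0 invr_eq0 (lt_eqF fv) orbF => /eqP.
have gspan : (g <= spanmx I)%MS.
  by rewrite addmx_sub ?apex_span// scalemx_sub// addmx_sub ?eqmx_opp ?apex_span.
have g1 : ev d g = 1 by rewrite evD evZ evB x1 v1 subrr mulr0 addr0.
split=> [[xF xm]|].
  rewrite JT poly_tightE//; split => //; split => //.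
  apply: contrapT => /(outside_facet_form gspan)[f' f'F]; apply/negP; rewrite -leNgt.
  have [f'I _ _] := f'F.
  have : ev f' v <= 0 by exact: pcone_nonpos f'I vc.
  rewrite le_eqVlt => /orP[/eqP f'v|f'v].
    rewrite evD f'v add0r evZ evB f'v subr0 pmulr_rle0 ?invr_gt0//.
    by case: xF => xc _; exact: pcone_nonpos f'I xc.
  have [TO E] := rel_height_form f'F f'v gspan.
  have : 0 <= rel_height (tight I f') g.
    rewrite gE rel_height_apex// -lerBlDl sub0r ler_pdivlMl//.
    by rewrite mulrN1 opprB lerD2r; exact: xm.
  by rewrite E ler_ndivlMr// mul0r.
rewrite -/g => gF.
have gFI : polytope I g by move: gF; rewrite JT poly_tightE// => -[].
have xE : x = s *: v + (1 - s) *: g.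
  rewrite /g scalerDr scalerA mulfV ?gt_eqF// scale1r addrA -scalerDl addrC.
  by rewrite [s + _]addrC subrK scale1r subrK.
split.
  split => //; rewrite xE; apply: pconeD; apply: pconeZ => //; first exact: ltW.
  by case: gFI.
move=> J' J'O; rewrite -/s [X in rel_height _ X]xE rel_heightD !rel_heightZ rel_height_apex//.
by rewrite mulr1 lerDl mulr_ge0 ?(ltW s1')// rel_height_ge0.
Qed.

(** If every facet contained the apex, nothing would block the direction from the apex
    to another point. *)
Lemma opp_index_neq0 i : i \in I -> p i <> v -> exists J, J \in opp_index.
Proof.
move=> iI pv; have [vc v1] := vI; apply: contrapT => h; apply: pv; apply/eqP; rewrite -subr_eq0; apply/eqP.
apply: no_recession.
- by rewrite addmx_sub ?eqmx_opp ?apex_span// mem_span.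
- by rewrite evB dp v1 subrr.
move=> f fF; have [fI _ _] := fF.
have : ev f v <= 0 by exact: pcone_nonpos fI vc.
rewrite le_eqVlt evB => /orP[/eqP->|fv]; first by rewrite subr0 fI.
by exfalso; apply: h; exists (tight I f); have [] := rel_height_form fF fv apex_span.
Qed.

Lemma pieces_cover i x : i \in I -> p i <> v -> polytope I x ->
  exists2 J, J \in opp_index & piece J x.
Proof.
move=> iI piv xF; have [J0 J0O] := opp_index_neq0 iI piv.
have [J JO Jmin] := arg_minP (fun J => rel_height J x) J0O.
by exists J => //; split.
Qed.

(** A facet contains precisely the points of relative height zero, so its relative height determines
    it.  This makes two distinct pieces overlap inside a proper hyperplane only. *)
Lemma rel_height_inj J J' : J \in opp_index -> J' \in opp_index ->
  (forall i, i \in I -> rel_height J (p i) = rel_height J' (p i)) -> J = J'.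
Proof.
move=> /opp_indexP[/facet_colP[_ JT] fv] /opp_indexP[/facet_colP[_ J'T] f'v] h.
rewrite JT J'T; apply/setP => i; rewrite !inE; case: (boolP (i \in I)) => //= iI.
have := h i iI; rewrite /rel_height => E.
have H k (a b : R) : b < 0 -> k = a / b -> (a == 0) = (k == 0).
  by move=> b0 ->; rewrite mulf_eq0 invr_eq0 (lt_eqF b0) orbF.
by rewrite (H _ _ _ fv erefl) E -(H _ _ _ f'v erefl).
Qed.

End Apex.

(** In positive dimension no facet is empty: if a facet form were nonzero at all points,
    its kernel in the span would be trivial, so the span would be a line, which
    meets the hyperplane [ev d x = 1] in one point. *)
Lemma facet_index_neq0 I J i j : i \in I -> j \in I -> p i <> p j ->
  J \in facet_index I -> exists k, k \in J.
Proof.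
move=> iI jI ij /facet_colP[[fI _ fT] JT]; set f := facet_col I J in fI fT JT.
apply: contrapT => h.
have f0 k : k \in I -> ev f (p k) != 0.
  by move=> kI; apply/negP => /eqP fk; apply: h; exists k; rewrite JT inE kI fk eqxx.
pose y := ev f (p j) *: p i - ev f (p i) *: p j.
have yI : (y <= spanmx I)%MS by rewrite addmx_sub ?eqmx_opp// scalemx_sub// mem_span.
have /(fT _ yI) : ev f y = 0 by rewrite evB !evZ mulrC subrr.
have -> : spanmx (tight I f) = 0.
  apply/row_matrixP => k; rewrite rowK row0 -JT; case: ifP => // kJ; exfalso; apply: h.
  by exists k.
move=> /submx0null y0.
have : ev d y = 0 by rewrite y0 raddf0.
rewrite evB !evZ !dp !mulr1 => /eqP; rewrite subr_eq0 => /eqP fij.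
move: y0; rewrite /y fij -scalerBr => /eqP; rewrite scaler_eq0 (negbTE (f0 i iI)) /=.
by rewrite subr_eq0 => /eqP.
Qed.

Lemma poly_neq0 I x : polytope I x -> exists i, i \in I.
Proof.
move=> [[c [_ cI ->]] /= x1]; apply: contrapT => h; move: x1.
rewrite big1 ?raddf0; first by move/esym/eqP; rewrite oner_eq0.
by move=> i _; rewrite cI ?scale0r//; apply/negP => iI; apply: h; exists i.
Qed.

Lemma poly_point J i : i \in J -> (forall j, j \in J -> p j = p i) -> polytope J = [set p i].
Proof.
move=> iJ Ji; apply/seteqP; split => [x|_ ->]; last exact: mem_poly.
move=> [[c [_ cJ ->]] /=]; rewrite ev_sum => c1.
rewrite (eq_bigr (fun j => (c j * ev d (p j)) *: p i)); last first.
  move=> j _; rewrite dp mulr1; have [/Ji->//|/cJ->] := boolP (j \in J).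
  by rewrite !scale0r.
by rewrite -scaler_suml c1 scale1r.
Qed.

(** A point at maximal distance from the origin is a vertex: the tangent hyperplane of the
    sphere through it supports the polytope and touches it in that point only. *)
Lemma exists_vertex I i0 : i0 \in I -> exists v, vertex (polytope I) v.
Proof.
move=> i0I; pose q i := ev (p i)^T (p i).
have [/= i iI0 imax] := arg_maxP q i0I; have iI : i \in I := iI0.
pose f := (p i)^T - q i *: d.
have fE x : ev f x = ev (p i)^T x - q i * ev d x by rewrite ev_formD ev_formN ev_formZ.
have sqE x : ev x^T x = \sum_k x 0 k ^+ 2.
  by rewrite /ev mxE; apply: eq_bigr => k _; rewrite mxE.
have distE j : \sum_k (p j - p i) 0 k ^+ 2 = q j + q i - 2 * ev (p i)^T (p j).
  rewrite /q !sqE /ev mxE mulr_sumr -big_split -sumrB; apply: eq_bigr => k _.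
  by rewrite !mxE /=; ring.
have dist0 j : 0 <= \sum_k (p j - p i) 0 k ^+ 2 by apply: sumr_ge0 => k _; exact: sqr_ge0.
have fI : nonpos I f.
  move=> j jI; rewrite fE dp mulr1; have := dist0 j; have := imax j jI; rewrite distE.
  by move=> /= h1 h2; lra.
exists (p i); rewrite /vertex; suff -> : [set p i] = polytope (tight I f) by exact: tight_face.
symmetry; apply: poly_point.
  by rewrite inE iI fE dp mulr1 subrr eqxx.
move=> j; rewrite inE fE dp mulr1 subr_eq0 => /andP[jI /eqP jf].
have : \sum_k (p j - p i) 0 k ^+ 2 = 0.
  apply/eqP; rewrite eq_le dist0 andbT distE jf; have := imax j jI => /= h; lra.
move=> /psumr_eq0P h; apply/rowP => k; apply/eqP; rewrite -subr_eq0.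
have : (p j - p i) 0 k ^+ 2 = 0 by apply: h => // l _; exact: sqr_ge0.
by move/eqP; rewrite sqrf_eq0 !mxE.
Qed.

Lemma vertex_point I v : vertex (polytope I) v -> exists2 i, i \in I & v = p i.
Proof.
move=> /face_tight[f fI vE].
have [|i iT] := @poly_neq0 (tight I f) v; first by rewrite -vE.
exists i; first exact: (fintype.subsetP (tight_sub I f)).
have : polytope (tight I f) (p i) by exact: mem_poly.
by rewrite -vE => /= ->.
Qed.

End Facets.

(** * Dimension *)

Section Dimension.
Variables (R : realType) (n : nat).
Implicit Types (X : set 'rV[R]_n) (U : {vspace 'rV[R]_n}) (w : 'rV[R]_n).

(** The direction of an affine subspace is determined by the subspace. *)
Lemma adimE X w U : aff X = [set w + u | u in [set u | u \in U]] -> adim X = \dim U.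
Proof.
move=> E; rewrite /adim; case: xgetP => [r _ [w' [U' [E' <-]]]|/(_ (\dim U))]; last first.
  by case; exists w, U.
have h (w1 w2 : 'rV[R]_n) (U1 U2 : {vspace 'rV[R]_n}) :
    [set w1 + u | u in [set u | u \in U1]] = [set w2 + u | u in [set u | u \in U2]] -> (U1 <= U2)%VS.
  move=> E12; apply/subvP => u uU1.
  have [u2 u2U /= e2] : [set w2 + u | u in [set u | u \in U2]] (w1 + u) by rewrite -E12; exists u.
  have [u3 u3U /= e3] : [set w2 + u | u in [set u | u \in U2]] w1.
    by rewrite -E12; exists 0; rewrite /= ?mem0v ?addr0.
  have -> : u = u2 - u3 by rewrite -(addKr w2 u2) e2 -{1}e3; apply/rowP => k; rewrite !mxE; ring.
  exact: memvB.
congr (\dim _); apply/eqP; rewrite eqEsubv; apply/andP.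
by split; [apply: (h w' w)|apply: (h w w')]; rewrite -E -E'.
Qed.

Lemma aff_point (x : 'rV[R]_n) : aff [set x] = [set x].
Proof.
apply/seteqP; split => [y|_ ->].
  move=> [k [a [q [qx a1 ->]]]]; rewrite (eq_bigr (fun i => a i *: x)).
    by rewrite -scaler_suml a1 scale1r.
  by move=> i _; rewrite qx.
exists 1%N, (fun=> 1), (fun=> x); split => //; first by rewrite big_ord1.
by rewrite big_ord1 scale1r.
Qed.

Lemma simplex_point (x : 'rV[R]_n) : simplex [set x].
Proof.
rewrite /simplex; have -> : adim [set x] = 0%N.
  rewrite (@adimE _ x 0%VS) ?dimv0// aff_point; apply/seteqP; split => y /=.
    by move=> ->; exists 0; rewrite /= ?mem0v ?addr0.
  by move=> [u /=]; rewrite memv0 => /eqP-> <-; rewrite addr0.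
rewrite (_ : [set v | _] = [set x]); first exact: card_set1.
apply/seteqP; split => v /=.
  move=> [l [c [_ E]]]; have : [set v] v by [].
  by rewrite E => -[].
move=> ->; exists \0, 0; split => //.
by apply/seteqP; split => y //= -[].
Qed.

End Dimension.

(** * Lattice bases of rational affine subspaces *)

Section IntegerMatrices.
Variable R : realType.
Notation toR := (toR R).

Lemma toRM m n k (A : 'M[int]_(m, n)) (B : 'M[int]_(n, k)) :
  toR (A *m B) = toR A *m toR B.
Proof. exact: map_mxM. Qed.

Lemma toR1 n : toR (1%:M : 'M[int]_n) = 1%:M.
Proof. exact: map_mx1. Qed.

Lemma toR_inj m n : injective (@toR m n).
Proof.
move=> A B /matrixP h; apply/matrixP => i j; have := h i j; rewrite !mxE.
exact: intr_inj.
Qed.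

Lemma toR_unit n (A : 'M[int]_n) : A \in unitmx -> toR A \in unitmx.
Proof.
move=> uA; have : toR A *m toR (invmx A) = 1%:M by rewrite -toRM mulmxV// toR1.
by move/mulmx1_unit => -[].
Qed.

(** By the Smith normal form, a rational subspace is spanned by some of the rows of an
    invertible integer matrix, so its integer points are a direct summand of the
    lattice. *)
Lemma smith_rows k n (M : 'M[int]_(k, n)) :
  exists (Q : 'M[int]_n) (S : {set 'I_n}), Q \in unitmx /\
    (toR M :=: toR (rowsub (@enum_val _ (mem S)) Q))%MS.
Proof.
have [L uL [Q uQ [D _ ME]]] := int_Smith_normal_form M.
pose DM : 'M[int]_(k, n) := \matrix_(i, j) (D`_i *+ (i == j :> nat)).
pose S : {set 'I_n} := finset (fun j : 'I_n => (j < k)%N && (D`_j != 0)).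
exists Q, S; split => //.
have rowDQ (i : 'I_k) : row i (toR (DM *m Q)) =
    if insub (i : nat) is Some j then (D`_i)%:~R *: row j (toR Q) else 0.
  apply/rowP => c; rewrite !mxE /DM rmorph_sum /=.
  case: insubP => [j jn ji|iN].
    rewrite (bigD1 j)//= big1 ?addr0.
      by rewrite !mxE ji eqxx mulr1n rmorphM.
    by move=> j' j'j; rewrite !mxE -ji eq_sym (inj_eq val_inj) (negbTE j'j) mulr0n mul0r.
  rewrite big1 ?mxE// => j' _; rewrite mxE; case: eqP => [E|_]; last by rewrite mulr0n mul0r.
  by move: iN; rewrite E ltn_ord.
have ME' : toR M = toR L *m toR (DM *m Q) by rewrite -toRM mulmxA -ME.
rewrite ME'; apply: eqmx_trans.
  by apply: eqmxMfull; rewrite row_full_unit toR_unit.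
apply/eqmxP/andP; split; apply/row_subP => i.
  rewrite rowDQ; case: insubP => [j jn ji|_]; last exact: sub0mx.
  have [->|Di] := eqVneq D`_i 0; first by rewrite scale0r sub0mx.
  have jS : j \in S by rewrite inE ji ltn_ord.
  apply: scalemx_sub; rewrite (_ : row j _ = row (enum_rank_in jS j) (toR (rowsub (@enum_val _ (mem S)) Q))).
    exact: row_sub.
  by apply/rowP => c; rewrite !mxE enum_rankK_in.
have := enum_valP i; rewrite inE => /andP[jk Dj]; set j := enum_val i in jk Dj *.
have Dj' : (D`_j)%:~R != 0 :> R by rewrite intr_eq0.
rewrite (_ : row i _ = ((D`_j)%:~R)^-1 *: row (Ordinal jk) (toR (DM *m Q))).
  by apply: scalemx_sub; exact: row_sub.
rewrite rowDQ /= insubT//= => jn; rewrite scalerA mulVf// scale1r.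
by apply/rowP => c; rewrite !mxE; congr (Q _ _)%:~R; exact: val_inj.
Qed.

(** An integer right inverse expresses that the rows are a basis of all integer points
    of the real subspace they span: it computes the coordinates of such a point, and
    they come out as integers. *)
Definition unimodular r n (e : 'M[int]_(r, n)) := exists B : 'M[int]_(n, r), e *m B = 1%:M.

Lemma unimodular_rowsub n (Q : 'M[int]_n) (S : {set 'I_n}) :
  Q \in unitmx -> unimodular (rowsub (@enum_val _ (mem S)) Q).
Proof.
move=> uQ; exists (colsub (@enum_val _ (mem S)) (invmx Q)).
apply/matrixP => i j; rewrite mxE.
have := congr1 (fun A : 'M[int]_n => A (enum_val i) (enum_val j)) (mulmxV uQ).
rewrite !mxE (inj_eq enum_val_inj) => <-.
by apply: eq_bigr => l _; rewrite !mxE.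
Qed.

Lemma unimodular_free r n (e : 'M[int]_(r, n)) : unimodular e -> row_free (toR e).
Proof. by move=> [B eB]; apply/row_freeP; exists (toR B); rewrite -toRM eB toR1. Qed.

Lemma unimodular_int r n k (e : 'M[int]_(r, n)) (Z : 'M[int]_(k, n)) : unimodular e ->
  (toR Z <= toR e)%MS -> exists A, Z = A *m e.
Proof.
move=> [B eB] /submxP[T ZE]; exists (Z *m B); apply: (@toR_inj k n).
by rewrite !toRM ZE -[T *m toR e *m toR B]mulmxA -toRM eB toR1 mulmx1.
Qed.

Lemma unimodular_basis r n (e : 'M[int]_(r, n)) (L : set 'rV[int]_n) : unimodular e ->
  L = [set z | (toR z <= toR e)%MS] -> lattice_basis L e.
Proof.
move=> ue ->; split.
- by move=> a _ /=; rewrite toRM submxMl.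
- case: ue => B eB a a' _ _ /(congr1 (fun X => X *m B)).
  by rewrite -!mulmxA eB !mulmx1.
- by move=> z /= /(unimodular_int ue)[a ->]; exists a.
Qed.

(** Two bases of a lattice differ by an invertible integer matrix, whose determinant is
    1 or -1.  This makes the lattice volume independent of the basis. *)
Lemma basis_change r n (e e' : 'M[int]_(r, n)) (L : set 'rV[int]_n) : unimodular e ->
  L = [set z | (toR z <= toR e)%MS] -> lattice_basis L e' ->
  exists2 N : 'M[int]_r, N \in unitmx & e' = N *m e.
Proof.
move=> ue LE [Lto Linj Lsurj]; have [B eB] := ue.
have rowL i : L (row i e') by rewrite rowE; exact: Lto.
have [N e'E] : exists N, e' = N *m e.
  apply: unimodular_int => //; apply/row_subP => i.
  by have := rowL i; rewrite LE /= /toR map_row.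
have : exists M, e = M *m e'.
  have h i : exists a : 'rV_r, row i e = a *m e'.
    have : L (row i e) by rewrite LE /= /toR map_row; exact: row_sub.
    by move=> /Lsurj[a _ <-]; exists a.
  exists (\matrix_i xget 0 [set a : 'rV_r | row i e = a *m e']).
  apply/row_matrixP => i; rewrite row_mul rowK.
  by case: xgetP => [a _ //|nh]; have [a /nh] := h i.
move=> [M eE]; exists N => //.
have : M *m N = 1%:M.
  have : M *m N *m e = e by rewrite -mulmxA -e'E -eE.
  by move=> /(congr1 (fun X => X *m B)); rewrite -mulmxA eB mulmx1.
by move=> /mulmx1_unit[].
Qed.

Lemma norm_det_unit r (N : 'M[int]_r) : N \in unitmx -> `|\det (toR N)| = 1.
Proof.
rewrite unitmxE => uN; rewrite /toR det_map_mx /= -intr_norm.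
have /orP[/eqP->|/eqP->] : (\det N == 1) || (\det N == -1) by exact: uN.
  by rewrite normr1.
by rewrite normrN normr1.
Qed.

(** Affine coordinates on [A] adapted to the lattice: an origin [w], which may be any point
    of [A], and a basis of the integer points of the direction of [A]. *)
Definition frame n (A : set 'rV[R]_n) r (e : 'M[int]_(r, n)) (w : 'rV[R]_n) :=
  unimodular e /\ forall x, A x <-> (x - w <= toR e)%MS.

Section Frames.
Variables (n : nat) (A : set 'rV[R]_n).
Implicit Types (w x : 'rV[R]_n).

Lemma frame_base r (e : 'M[int]_(r, n)) w : frame A e w -> A w.
Proof. by move=> [_ ->]; rewrite subrr sub0mx. Qed.

Lemma frame_rebase r (e : 'M[int]_(r, n)) w w' : frame A e w -> A w' -> frame A e w'.
Proof.
move=> [ue AE] /AE w'e; split => // x; rewrite AE.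
split => h.
  have -> : x - w' = (x - w) - (w' - w) by rewrite opprB addrA subrK.
  by rewrite addmx_sub ?eqmx_opp.
have -> : x - w = (x - w') + (w' - w) by rewrite addrA subrK.
exact: addmx_sub.
Qed.

Lemma frame_coord r (e : 'M[int]_(r, n)) w x : frame A e w -> A x ->
  exists t, x = w + t *m toR e.
Proof. by move=> [_ AE] /AE/submxP[t h]; exists t; rewrite -h addrC subrK. Qed.

Lemma frame_mem r (e : 'M[int]_(r, n)) w t : frame A e w -> A (w + t *m toR e).
Proof. by move=> [_ AE]; rewrite AE addrC addKr submxMl. Qed.

Lemma frame_lattice r (e : 'M[int]_(r, n)) w w' : frame A e w -> A w' ->
  lattice_of A w' = [set z | (toR z <= toR e)%MS].
Proof.
move=> fe /(frame_rebase fe)[_ AE]; apply/seteqP.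
by split => z; rewrite /lattice_of /= AE addrC addKr.
Qed.

Lemma frame_adim Q r (e : 'M[int]_(r, n)) w : aff Q = A -> frame A e w -> adim Q = r.
Proof.
move=> QA fe; have [ue _] := fe.
pose h : 'Hom('rV[R]_r, 'rV[R]_n) := linfun (mulmxr (toR e)).
have hE t : h t = t *m toR e by rewrite lfunE.
rewrite (@adimE _ _ Q w (limg h)).
  rewrite limg_dim_eq ?dimvf/= /dim/= ?mul1n//.
  apply/eqP; rewrite -subv0; apply/subvP => t; rewrite memv_cap => /andP[_].
  rewrite memv_ker hE memv0 => /eqP te; apply/eqP.
  by apply: (row_free_inj (unimodular_free ue)); rewrite te mul0mx.
rewrite QA; apply/seteqP; split => x /=.
  by move=> /(frame_coord fe)[t ->]; exists (t *m toR e) => //=; rewrite -hE memv_img ?memvf.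
by move=> [u /= /memv_imgP[t _ ->] <-]; rewrite hE; exact: frame_mem.
Qed.

End Frames.
End IntegerMatrices.

(** * Lattice volume in a frame *)

Section Extension.
Variables (R : realType) (n : nat).
Notation toR := (toR R).

(** A lattice basis of the direction of a rational hyperplane [B] of [A] extends to one of
    the direction of [A] by a single vector [z].  The column [c] is the primitive form
    that cuts out [B].  In coordinates with respect to [eF], the rows of [eG] are
    combinations of the rows other than [i0] of an invertible integer matrix; row [i0]
    and the corresponding column of the inverse provide [z] and [c]. *)
Lemma frame_extend (A B : set 'rV[R]_n) r (eF : 'M[int]_(r, n)) k (eG : 'M[int]_(k, n)) w
    (f : 'cV[R]_n) :
  frame A eF w -> frame B eG w -> B `<=` A ->
  (forall x, A x -> ev f (x - w) = 0 <-> B x) -> ~ A `<=` B ->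
  exists (z : 'rV[int]_n) (c : 'cV[int]_n),
    [/\ z *m c = 1%:M, eG *m c = 0 & frame A (col_mx z eG : 'M[int]_(1 + k, n)) w].
Proof.
move=> [[BF eBF] AE] [[BG eBG] BE] BA fAB AB.
have F_G (u : 'rV[R]_n) : (u <= toR eF)%MS -> ev f u = 0 -> (u <= toR eG)%MS.
  move=> uF fu; have := BE (w + u); rewrite [w + u]addrC addrK => <-.
  by apply/fAB; [rewrite AE addrK|rewrite addrK].
have G_F (u : 'rV[R]_n) : (u <= toR eG)%MS -> (u <= toR eF)%MS /\ ev f u = 0.
  move=> uG; have Bu : B (w + u) by rewrite BE addrC addKr.
  have Au := BA _ Bu; split; first by move: Au; rewrite AE addrC addKr.
  by have := (fAB _ Au).2 Bu; rewrite addrC addKr.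
have eGF : (toR eG <= toR eF)%MS by apply/row_subP => i; case: (G_F _ (row_sub i (toR eG))).
have [M eGE] := unimodular_int (ex_intro _ BF eBF) eGF.
have [Q [S [uQ MQ]]] := smith_rows R M.
(* Otherwise the rows of eG would span the whole direction of A. *)
have [i0 i0S] : exists i0, i0 \notin S.
  apply: contrapT => h; apply: AB => x; rewrite AE BE => /submxP[t ->].
  have tM : (t <= toR M)%MS.
    rewrite MQ; have -> : t = (t *m invmx (toR Q)) *m toR Q by rewrite mulmxKV// toR_unit.
    apply: submx_trans (submxMl _ _) _; apply/row_subP => i.
    have iS : i \in S by apply: contrapT => /negP iS; apply: h; exists i.
    rewrite (_ : row i _ = row (enum_rank_in iS i) (toR (rowsub (@enum_val _ (mem S)) Q))).
      exact: row_sub.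
    by apply/rowP => c; rewrite !mxE enum_rankK_in.
  by move/submxP: tM => [T ->]; rewrite -mulmxA -toRM -eGE submxMl.
pose c : 'cV[int]_n := BF *m invmx Q *m delta_mx i0 0.
pose z : 'rV[int]_n := row i0 Q *m eF.
have zc : z *m c = 1%:M.
  rewrite /z /c !mulmxA -(mulmxA (row i0 Q)) eBF mulmx1 -row_mul mulmxV//.
  by rewrite row1 -rowE; apply/matrixP => i j; rewrite !ord1 !mxE !eqxx.
have eGc : eG *m c = 0.
  rewrite eGE /c !mulmxA -(mulmxA M) eBF mulmx1.
  apply: (@toR_inj R); rewrite !toRM.
  have /submxP[Y ->] : (toR M <= toR (rowsub (@enum_val _ (mem S)) Q))%MS by rewrite MQ.
  rewrite -!mulmxA -toRM -toRM [X in Y *m toR X](_ : _ = 0); last first.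
    apply/matrixP => i j; rewrite ord1 mulmxA -colE !mxE.
    have := congr1 (fun X : 'M[int]_r => X (enum_val i) i0) (mulmxV uQ).
    rewrite !mxE; under [in X in _ -> X]eq_bigr do rewrite !mxE.
    move=> ->; case: eqP => // ii; move: i0S; rewrite -ii.
    by rewrite enum_valP.
  by rewrite /toR !map_mx0 mulmx0.
have zF : (toR z <= toR eF)%MS by rewrite /z toRM submxMl.
clearbody z c; exists z, c; split => //.
have zc' : toR z *m toR c = 1%:M by rewrite -toRM zc toR1.
have fz : ev f (toR z) != 0.
  apply/negP => /eqP /(F_G _ zF)/submxP[T zE].
  have : toR z *m toR c = 0 by rewrite zE -mulmxA -toRM eGc /toR map_mx0 mulmx0.
  by rewrite zc' => /matrixP/(_ 0 0)/eqP; rewrite !mxE eqxx oner_eq0.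
split.
  exists (row_mx c (BG - c *m (z *m BG))).
  rewrite mul_col_row zc eGc !mulmxBr !mulmxA zc eGc mul1mx !mul0mx subr0 eBG subrr.
  by rewrite -scalar_mx_block.
move=> x; rewrite AE /toR map_col_mx; set u := x - w.
suff E : (u <= toR eF)%MS = (u <= col_mx (toR z) (toR eG))%MS by rewrite E.
apply/idP/idP; last first.
  by move=> /submx_trans; apply; rewrite col_mx_sub zF.
move=> uF; pose k0 := ev f u / ev f (toR z).
have : (u - k0 *: toR z <= toR eG)%MS.
  apply: F_G; first by rewrite addmx_sub// eqmx_opp scalemx_sub.
  by rewrite evB evZ divfK// subrr.
move=> h; rewrite -[u](subrK (k0 *: toR z)) -addsmxE addmx_sub//.
  by apply: submx_trans h _; exact: addsmxSr.
by rewrite scalemx_sub// addsmxSl.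
Qed.

End Extension.

Section Volume.
Variables (R : realType) (n : nat).
Notation toR := (toR R).
Implicit Types (Q X A : set 'rV[R]_n) (w : 'rV[R]_n).

Definition frame_coords r (e : 'M[int]_(r, n)) w X : set 'rV[R]_r :=
  [set t | X (w + t *m toR e)].

Lemma frame_coords_leb A X r (e e' : 'M[int]_(r, n)) w w' (N : 'M[int]_r) :
  frame A e w -> A w' -> N \in unitmx -> e' = N *m e ->
  measurable (frame_coords e w X : set (borel_rV R r)) ->
  leb R r (frame_coords e' w' X) = leb R r (frame_coords e w X).
Proof.
move=> fe /(frame_coord fe)[t0 ->] uN -> mX.
rewrite -(leb_affine t0 (toR_unit R uN) mX) norm_det_unit// mul1e.
congr (leb R r _); apply/seteqP; split => t; rewrite /frame_coords /= toRM mulmxDl mulmxA;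
  by rewrite -addrA [t0 *m _ + _]addrC.
Qed.

Lemma frame_change A r (e e' : 'M[int]_(r, n)) w w' :
  frame A e w -> frame A e' w' -> exists2 N : 'M[int]_r, N \in unitmx & e' = N *m e.
Proof.
move=> fe fe'; have Aw := frame_base fe; have [ue _] := fe; have [ue' _] := fe'.
apply: (@basis_change R _ _ e e' _ ue erefl).
rewrite -(frame_lattice fe Aw); apply: unimodular_basis ue' _.
exact: (frame_lattice fe').
Qed.

Lemma frame_indep A X r (e : 'M[int]_(r, n)) w r' (e' : 'M[int]_(r', n)) w' :
  r = r' -> frame A e w -> frame A e' w' ->
  measurable (frame_coords e w X : set (borel_rV R r)) ->
  leb R r' (frame_coords e' w' X) = leb R r (frame_coords e w X).
Proof.
move=> rr; subst r' => fe fe' mX; have [N uN e'E] := frame_change fe fe'.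
exact: (frame_coords_leb fe (frame_base fe') uN e'E mX).
Qed.

(** The denominator in the lattice volume is the same for all bases. *)
Lemma coords_simplex r (e : 'M[int]_(r, n)) : row_free (toR e) ->
  coords e (conv_hull ([set 0] `|` [set toR (row i e) | i in setT])) = @std_simplex R r.
Proof.
move=> fe; apply/seteqP; split => t; rewrite /coords /std_simplex /=.
  move=> [k [a [q [qX a0 a1 te]]]].
  have hq i : exists s : 'rV[R]_r, q i = s *m toR e /\ std_simplex s.
    case: (qX i) => [->|[j _ <-]].
      exists 0; rewrite mul0mx; split => //; split => [j|]; first by rewrite mxE.
      by rewrite big1 ?ler01// => j _; rewrite mxE.
    exists (delta_mx 0 j); rewrite -rowE /toR map_row; split => //; split => [l|].
      by rewrite mxE ler0n.
    rewrite (bigD1 j)//= big1 ?addr0 ?mxE ?eqxx// => l /negbTE lj.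
    by rewrite mxE lj andbF.
  pose s i := xget 0 [set s : 'rV[R]_r | q i = s *m toR e /\ std_simplex s].
  have sP i : q i = s i *m toR e /\ std_simplex (s i).
    by rewrite /s; case: xgetP => [s' _ //|nh]; have [s' /nh] := hq i.
  have -> : t = \sum_i a i *: s i.
    apply: (row_free_inj fe); rewrite te mulmx_suml; apply: eq_bigr => i _.
    by rewrite -scalemxAl; case: (sP i) => <-.
  have tE j : (\sum_i a i *: s i) 0 j = \sum_i a i * s i 0 j.
    by rewrite summxE; apply: eq_bigr => i _; rewrite mxE.
  split => [j|].
    by rewrite tE sumr_ge0// => i _; rewrite mulr_ge0//; case: (sP i) => _ [].
  under eq_bigr do rewrite tE.
  rewrite exchange_big -a1; apply: ler_sum => i _; rewrite -mulr_sumr.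
  by rewrite ler_piMr//; case: (sP i) => _ [].
move=> [t0 t1].
exists r.+1, (fun i => if unlift ord0 i is Some j then t 0 j else 1 - \sum_j t 0 j),
  (fun i => if unlift ord0 i is Some j then toR (row j e) else 0); split.
- move=> i; case: (unliftP ord0 i) => [j|] _; [right|left] => //=.
  by exists j.
- by move=> i; case: (unliftP ord0 i) => [j|] _; rewrite ?subr_ge0.
- rewrite big_ord_recl unlift_none; under [X in _ + X]eq_bigr do rewrite liftK.
  by rewrite subrK.
- rewrite big_ord_recl unlift_none scaler0 add0r mulmx_sum_row; apply: eq_bigr => j _.
  by rewrite liftK /toR map_row.
Qed.

(** The lattice volume may be computed in any frame, because the change of frame is an affine
    map of determinant 1 or -1. *)
Lemma lattice_volumeE Q r (e : 'M[int]_(r, n)) w : frame (aff Q) e w -> ~ aff Q 0 ->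
  measurable (frame_coords e w Q : set (borel_rV R r)) ->
  lattice_volume Q = fine (leb R r (frame_coords e w Q)) / fine (leb R r (@std_simplex R r)).
Proof.
move=> fe A0 mQ; have rE := frame_adim erefl fe; rewrite /lattice_volume.
move: (adim Q) rE => r' rE; subst r'.
have Aw := frame_base fe; have [ue _] := fe.
have val w' (e' : 'M[int]_(r, n)) : base_point (aff Q) w' -> lattice_basis (lattice_of (aff Q) w') e' ->
    fine (lebesgue_rV (coords e' [set y | Q (w' + y)])) /
              fine (lebesgue_rV (coords e'
                (conv_hull ([set 0] `|` [set toR (row i e') | i in setT])))) =
    fine (leb R r (frame_coords e w Q)) / fine (leb R r (@std_simplex R r)).
  move=> [Aw' _]; rewrite (frame_lattice fe Aw') => /(basis_change ue erefl)[N uN e'E].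
  have fe'' : row_free (toR e').
    apply: unimodular_free; have [B eB] := ue; exists (B *m invmx N).
    by rewrite e'E mulmxA -(mulmxA N) eB mulmx1 mulmxV.
  rewrite coords_simplex// -!lebE.
  by rewrite -(frame_coords_leb fe Aw' uN e'E mQ).
case: xgetP => [vol _ [w' [e' [h1 h2 ->]]]|]; first exact: val.
move=> /(_ (fine (leb R r (frame_coords e w Q)) / fine (leb R r (@std_simplex R r))))[].
exists w, e.
have bw : base_point (aff Q) w by [].
have be : lattice_basis (lattice_of (aff Q) w) e.
  by apply: unimodular_basis ue _; exact: frame_lattice fe Aw.
by split => //; rewrite val.
Qed.

End Volume.

(** * Lattice height in a frame *)

Section Height.
Variables (R : realType) (n k : nat).
Notation toR := (toR R).
Variables (A B : set 'rV[R]_n) (z : 'rV[int]_n) (e : 'M[int]_(k, n)) (w : 'rV[R]_n)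
  (c : 'cV[int]_n).
Hypotheses (zc : z *m c = 1%:M) (ec : e *m c = 0).
Hypotheses (fB : frame B e w) (fA : frame A (col_mx z e : 'M[int]_(1 + k, n)) w).

Lemma ev_col_z : ev (toR c) (toR z) = 1.
Proof. by rewrite /ev -toRM zc toR1 mxE eqxx. Qed.

Lemma ev_col_e (y : 'rV[R]_k) : ev (toR c) (y *m toR e) = 0.
Proof. by rewrite /ev -mulmxA -toRM ec /toR map_mx0 mulmx0 mxE. Qed.

Lemma mul_row_frame (s : R) (y : 'rV[R]_k) :
  (cons_rV (s, y) : 'rV[R]_(1 + k)) *m toR (col_mx z e) = s *: toR z + y *m toR e.
Proof. by rewrite /cons_rV /= /toR map_col_mx mul_row_col mul_scalar_mx. Qed.

Lemma frame_split x : A x -> exists y : 'rV[R]_k,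
  x = w + (ev (toR c) (x - w) *: toR z + y *m toR e).
Proof.
move=> /(frame_coord fA)[t xE]; exists (behead_rV t).
move: xE; rewrite -{1}(cons_rVK t) mul_row_frame => ->.
by rewrite [w + _]addrC addrK evD evZ ev_col_z ev_col_e mulr1 addr0 addrC.
Qed.

Lemma frame_facet_mem x : A x -> ev (toR c) (x - w) = 0 <-> B x.
Proof.
move=> Ax; split => [h|/(frame_coord fB)[t ->]].
  by have [y ->] := frame_split Ax; rewrite h scale0r add0r; exact: frame_mem.
by rewrite addrC addKr ev_col_e.
Qed.

Lemma frame_facet_sub : B `<=` A.
Proof.
move=> x /(frame_coord fB)[t ->]; rewrite -[_ *m _]add0r -(scale0r (toR z)) -mul_row_frame.
exact: frame_mem.
Qed.

Variable v : 'rV[R]_n.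
Hypotheses (Av : A v) (Bv : ~ B v).

Lemma ev_col_apex : ev (toR c) (v - w) != 0.
Proof. by apply/negP => /eqP/(frame_facet_mem Av). Qed.

(** The lattice height refers to the affine hull of the facet and the apex, which is the
    affine hull of the whole polytope. *)
Lemma aff_facet_apex : aff (B `|` [set v]) = A.
Proof.
have [_ AE] := fA.
apply/seteqP; split => x.
  move=> [j [a [q [qB a1 ->]]]]; rewrite AE.
  have -> : \sum_i a i *: q i - w = \sum_i a i *: (q i - w).
    under [RHS]eq_bigr do rewrite scalerBr.
    by rewrite sumrB -scaler_suml a1 scale1r.
  apply: summx_sub => i _; apply: scalemx_sub; rewrite -AE.
  by case: (qB i) => [/frame_facet_sub|->].
move=> Ax; have [y xE] := frame_split Ax; have [yv vE] := frame_split Av.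
have s0 := ev_col_apex; set s := ev _ (v - w) in vE s0; set s' := ev _ (x - w) in xE.
pose K := s' / s; pose g := w + (y - K *: yv) *m toR e.
have Bg : B g by exact: frame_mem.
have Bw := frame_base fB.
(* An affine combination of the apex, a point of the facet and the origin w. *)
exists 3%N, (fun i : 'I_3 => if i == 0 :> nat then K else if i == 1%N :> nat then 1 else - K),
   (fun i : 'I_3 => if i == 0 :> nat then v else if i == 1%N :> nat then g else w).
split.
- by move=> [[|[|i]] hi] /=; [right|left|left].
- by rewrite !big_ord_recl big_ord0 /=; ring.
- rewrite !big_ord_recl big_ord0 /= addr0 scale1r xE /g mulmxBl -scalemxAl [in RHS]vE.
  rewrite !scalerDr !scalerA /K divfK// scaleNr.
  by apply/rowP => j; rewrite !mxE; ring.
Qed.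

(** Any primitive form that is constant on [B] is a multiple of [c] on the direction of [A], and
    the factor, an integer dividing 1, is 1 or -1. *)
Lemma lattice_heightE : ~ A 0 -> lattice_height B v = `|ev (toR c) (v - w)|.
Proof.
move=> A0; rewrite /lattice_height aff_facet_apex.
case: ifPn => [|_]; first by rewrite inE.
have Aw := frame_base fA.
have ue : unimodular (col_mx z e : 'M[int]_(1 + k, n)) by case: fA.
have latP w' : A w' -> lattice_of A w' = [set y | (toR y <= toR (col_mx z e : 'M[int]_(1 + k, n)))%MS].
  by move=> Aw'; exact: frame_lattice fA Aw'.
have latz : (toR z <= toR (col_mx z e : 'M[int]_(1 + k, n)))%MS.
  by rewrite /toR map_col_mx -addsmxE addsmxSl.
case: xgetP => [h _ [w' [l [b [[Aw' _] [lint [y Ly ly]] lB ->]]]]|nh].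
  rewrite (latP _ Aw') in lint Ly.
  have lB' x : A x -> B x <-> l (x - w') = b.
    by move=> Ax; rewrite -(lB (x - w')) addrC subrK.
  have bE : l (w - w') = b by apply/(lB' _ Aw); exact: (frame_base fB).
  have le (t : 'rV[R]_k) : l (t *m toR e) = 0.
    have Bt : B (w + t *m toR e) by exact: frame_mem.
    have := (lB' _ (frame_facet_sub Bt)).1 Bt.
    by rewrite addrAC linearD /= bE => /eqP; rewrite -subr_eq0 addrC addKr => /eqP.
  have lz : `|l (toR z)| = 1.
    have [a yE] : exists a : 'rV[int]_(1 + k), y = a *m col_mx z e.
      exact: (unimodular_int ue Ly).
    have aE : toR y = (a 0 0)%:~R *: toR z + toR (rsubmx a) *m toR e.
      rewrite yE -[a in LHS]hsubmxK mul_row_col /toR map_mxD !map_mxM; congr (_ + _).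
      rewrite [lsubmx a]mx11_scalar map_scalar_mx mul_scalar_mx mxE.
      by congr ((a _ _)%:~R *: _); exact: val_inj.
    have := ly; rewrite aE linearD linearZ /= le addr0 => laz.
    have /intrP[q qE] := lint z latz.
    rewrite qE -intrM in laz; rewrite qE -intr_norm.
    have : (a 0 0 * q) = 1 by apply: (@intr_inj R).
    move=> /(congr1 absz); rewrite abszM => /eqP; rewrite muln_eq1 => /andP[_ /eqP q1].
    by rewrite -abszE q1.
  have [yv vE] := frame_split Av.
  have -> : v - w' = (w - w') + (ev (toR c) (v - w) *: toR z + yv *m toR e).
    by rewrite {1}vE addrAC.
  rewrite linearD /= bE addrAC subrr add0r linearD /= le addr0 linearZ /=.
  by rewrite normrM lz mulr1.
exfalso; apply: (nh `|ev (toR c) (v - w)|); exists w, (ev (toR c) : {scalar 'rV[R]_n}), 0; split.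
- by split.
- split; last by exists z; [rewrite (latP _ Aw)|exact: ev_col_z].
  by move=> y _; rewrite /= /ev -toRM mxE; exact: intr_int.
- move=> y Ay; have := frame_facet_mem Ay; rewrite addrC addKr => h.
  by split => [/h|/h].
- by rewrite subr0.
Qed.

End Height.

(** * Polytopes in coordinates *)

Section PolytopeFrames.
Variables (R : realType) (n m : nat) (v : 'I_m -> 'rV[int]_n) (d : 'cV[R]_n).
Notation toR := (toR R).
Let p i : 'rV[R]_n := toR (v i).
Hypothesis dp : forall i, ev d (p i) = 1.
Notation polytope := (polytope p d).
Notation spanmx := (spanmx p).
Implicit Types (I J : {set 'I_m}) (w x : 'rV[R]_n).

Lemma aff_span_poly I x : aff (polytope I) x -> (x <= spanmx I)%MS /\ ev d x = 1.
Proof.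
move=> [k [a [q [qP a1 ->]]]]; split.
  apply: summx_sub => i _; apply: scalemx_sub.
  by case: (qP i) => h _; exact: pcone_span h.
rewrite linear_sum /= -a1; apply: eq_bigr => i _; rewrite evZ.
by case: (qP i) => _ /= ->; rewrite mulr1.
Qed.

Lemma span_aff_poly I i0 x : i0 \in I -> (x <= spanmx I)%MS -> ev d x = 1 -> aff (polytope I) x.
Proof.
move=> i0I /submxP[a xE] x1.
pose a' i := if i \in I then a 0 i else 0.
have xE' : x = \sum_i a' i *: p i.
  rewrite xE mulmx_sum_row; apply: eq_bigr => i _; rewrite rowK /a'.
  by case: ifP => // _; rewrite scaler0 scale0r.
exists m, a', (fun i => if i \in I then p i else p i0); split.
- by move=> i; case: ifP => iI; exact: mem_poly.
- by rewrite -x1 xE' ev_sum; apply: eq_bigr => i _; rewrite dp mulr1.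
- rewrite xE'; apply: eq_bigr => i _; rewrite /a'; case: ifP => // _.
  by rewrite !scale0r.
Qed.

Lemma aff_poly0 I : ~ aff (polytope I) 0.
Proof. by move=> /aff_span_poly[_]; rewrite raddf0 => /esym/eqP; rewrite oner_eq0. Qed.

Lemma poly_frame I i0 : i0 \in I ->
  exists r (e : 'M[int]_(r, n)), frame (aff (polytope I)) e (p i0).
Proof.
move=> i0I.
pose M : 'M[int]_(m, n) := \matrix_i (if i \in I then v i - v i0 else 0).
have [Q [S [uQ MQ]]] := smith_rows R M.
exists _, (rowsub (@enum_val _ (mem S)) Q); split; first exact: unimodular_rowsub.
move=> x; rewrite -MQ.
have rowM i : row i (toR M) = if i \in I then p i - p i0 else 0.
  rewrite /toR -map_row rowK; case: ifP => _; last by rewrite map_mx0.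
  by rewrite map_mxB.
split.
  move=> /aff_span_poly[/submxP[a xE] x1].
  have -> : x - p i0 = a *m toR M.
    rewrite mulmx_sum_row; under eq_bigr do rewrite rowM.
    have a1 : \sum_i (if i \in I then a 0 i else 0) = 1.
      rewrite -x1 xE mulmx_sum_row linear_sum; apply: eq_bigr => i _ /=.
      rewrite evZ rowK; case: ifP => _; first by rewrite dp mulr1.
      by rewrite raddf0 mulr0.
    rewrite xE mulmx_sum_row -[X in _ - X]scale1r -a1 scaler_suml -sumrB.
    apply: eq_bigr => i _; rewrite rowK; case: ifP => _; first by rewrite scalerBr.
    by rewrite !scaler0 scale0r subr0.
  exact: submxMl.
move=> /submxP[a xE]; apply: (span_aff_poly i0I).
  rewrite -[x](subrK (p i0)) addmx_sub ?mem_span// xE.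
  apply: submx_trans (submxMl _ _) _; apply/row_subP => i; rewrite rowM.
  by case: ifP => iI; rewrite ?sub0mx// addmx_sub ?eqmx_opp ?mem_span.
rewrite -[x](subrK (p i0)) evD dp xE mulmx_sum_row linear_sum big1 ?add0r// => i _ /=.
rewrite evZ rowM; case: ifP => _; last by rewrite raddf0 mulr0.
by rewrite evB !dp subrr mulr0.
Qed.

Lemma ev_affine r (e : 'M[int]_(r, n)) w (f : 'cV[R]_n) t :
  ev f (w + t *m toR e) = ev f w + (t *m (toR e *m f)) 0 0.
Proof. by rewrite evD /ev mulmxA. Qed.

Lemma measurable_affine_le r (e : 'M[int]_(r, n)) w (f : 'cV[R]_n) :
  measurable ([set t : 'rV[R]_r | ev f (w + t *m toR e) <= 0] : set (borel_rV R r)).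
Proof.
have := measurable_halfspace (toR e *m f) (- ev f w).
congr (measurable _); apply/seteqP.
by split => t /=; rewrite ev_affine -lerBrDl sub0r.
Qed.

(** A polytope is the intersection of the half-spaces of its facets within its affine hull. *)
Lemma measurable_poly I r (e : 'M[int]_(r, n)) w : frame (aff (polytope I)) e w ->
  measurable (frame_coords e w (polytope I) : set (borel_rV R r)).
Proof.
move=> fe.
rewrite (_ : frame_coords _ _ _ = [set t : 'rV[R]_r | forall J : {set 'I_m},
    [set t : 'rV[R]_r | J \in facet_index p I -> ev (facet_col p I J) (w + t *m toR e) <= 0] t]).
  apply: (@measurable_forall _ (borel_rV R r)) => J.
  case: (boolP (J \in facet_index p I)) => JF.
    have := measurable_affine_le e w (facet_col p I J).
    by congr (measurable _); apply/seteqP; split => t /= h // ; exact: h.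
  rewrite (_ : [set t | _] = setT); first exact: measurableT.
  by apply/seteqP; split.
apply/seteqP; split => t; rewrite /frame_coords /=;
  have [h1 h2] := aff_span_poly (frame_mem t fe); by move=> /(poly_halfspaces h1 h2).
Qed.

(** The coordinates of a convex combination are bounded by those of the points combined. *)
Lemma bounded_poly I r (e : 'M[int]_(r, n)) w : frame (aff (polytope I)) e w ->
  exists K : R, forall t, frame_coords e w (polytope I) t -> forall j, `|t 0 j| <= K.
Proof.
move=> [[B eB] _].
pose q i := (p i - w) *m toR B.
exists (\sum_i \sum_j `|q i 0 j|) => t [[c [c0 cI wE]] w1] j.
have c1 : \sum_i c i = 1.
  by rewrite -w1 /= wE ev_sum; apply: eq_bigr => i _; rewrite dp mulr1.
have tE : t = \sum_i c i *: q i.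
  have -> : \sum_i c i *: q i = (\sum_i c i *: p i - w) *m toR B.
    rewrite -[X in _ - X]scale1r -c1 scaler_suml -sumrB mulmx_suml; apply: eq_bigr => i _.
    by rewrite /q -scalerBr scalemxAl.
  by rewrite -wE addrC addKr -mulmxA -toRM eB toR1 mulmx1.
rewrite tE summxE; apply: le_trans (ler_norm_sum _ _ _) _; apply: ler_sum => i _.
rewrite mxE normrM (ger0_norm (c0 i)).
have ci1 : c i <= 1.
  by rewrite -c1 (bigD1 i)//= lerDl sumr_ge0.
apply: le_trans (ler_piMl _ ci1) _ => //.
by rewrite (bigD1 j)//= lerDl sumr_ge0.
Qed.

End PolytopeFrames.

(** * The pyramid formula *)

Lemma sub_aff (R : realType) n (X : set 'rV[R]_n) : X `<=` aff X.
Proof.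
move=> x Xx; exists 1%N, (fun=> 1), (fun=> x); split => //; first by rewrite big_ord1.
by rewrite big_ord1 scale1r.
Qed.

Section Pyramids.
Variables (R : realType) (n m : nat) (v : 'I_m -> 'rV[int]_n) (d : 'cV[R]_n).
Notation toR := (toR R).
Let p i : 'rV[R]_n := toR (v i).
Hypothesis dp : forall i, ev d (p i) = 1.
Notation polytope := (polytope p d).
Notation spanmx := (spanmx p).
Variables (I : {set 'I_m}) (x0 : 'rV[R]_n).
Hypothesis x0I : polytope I x0.
Notation opp_index := (opp_index p I x0).
Notation rel_height := (rel_height p I x0).
Notation piece := (piece p d I x0).
Implicit Types (J : {set 'I_m}) (w x : 'rV[R]_n).

Let rel_col J : 'cV[R]_n := (ev (facet_col p I J) x0)^-1 *: facet_col p I J.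

Let rel_colE J x : rel_height J x = ev (rel_col J) x.
Proof. by rewrite ev_formZ mulrC. Qed.

Lemma measurable_piece J r (e : 'M[int]_(r, n)) w : frame (aff (polytope I)) e w ->
  measurable (frame_coords e w (piece J) : set (borel_rV R r)).
Proof.
move=> fe.
rewrite (_ : frame_coords _ _ _ = frame_coords e w (polytope I) `&`
  [set t : 'rV[R]_r | forall J' : {set 'I_m},
    [set t : 'rV[R]_r | J' \in opp_index -> rel_height J (w + t *m toR e) <= rel_height J' (w + t *m toR e)] t]).
  apply: measurableI; first exact: measurable_poly.
  apply: (@measurable_forall _ (borel_rV R r)) => J'.
  case: (boolP (J' \in opp_index)) => JF.
    have := measurable_affine_le e w (rel_col J - rel_col J').
    congr (measurable _); apply/seteqP; split => t /=;
      rewrite ev_formD ev_formN -!rel_colE subr_le0 // => h; exact: h.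
  rewrite (_ : [set t | _] = setT); first exact: measurableT.
  by apply/seteqP; split.
by apply/seteqP; split => t; rewrite /frame_coords /piece /=.
Qed.

(** The volume of a pyramid is height times volume of the base.  In a frame of the polytope that
    extends a frame of the facet, an affine map of determinant [s], the signed height of
    the apex, takes the pyramid to one with apex at the first unit vector over the same
    base; the factor of [leb_pyramid] then cancels against that of
    [leb_std_simplexS]. *)
Lemma piece_volume J j0 r (e : 'M[int]_(r, n)) w : J \in opp_index -> j0 \in J ->
  frame (aff (polytope I)) e w ->
  fine (leb R r (frame_coords e w (piece J))) / fine (leb R r (@std_simplex R r)) =
  lattice_height (aff (polytope J)) x0 * lattice_volume (polytope J).
Proof.
move=> JO j0J fe.
have [JF f0] := opp_indexP JO; have [fF JT] := facet_colP JF.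
set f := facet_col p I J in f0 fF JT.
have [fI _ fT] := fF.
have JI : J \subset I by rewrite JT tight_sub.
have fJ x : (x <= spanmx J)%MS -> ev f x = 0.
  by move=> /span_ev0; apply => i; rewrite JT inE => /andP[_ /eqP].
pose wG := p j0.
have [k [eG feG]] := poly_frame dp j0J.
have BA : aff (polytope J) `<=` aff (polytope I).
  move=> x [l [a [q [qJ a1 xE]]]]; exists l, a, q; split => // i; exact: (poly_sub JI).
have AwG : aff (polytope I) wG by apply: BA; exact: frame_base feG.
have fwG : ev f wG = 0 by apply: fJ; exact: mem_span.
have Ax0 : aff (polytope I) x0 by exact: sub_aff.
have nBx0 : ~ aff (polytope J) x0.
  by move=> /aff_span_poly[/fJ h _]; move: f0; rewrite h ltxx.
have fAB x : aff (polytope I) x -> ev f (x - wG) = 0 <-> aff (polytope J) x.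
  move=> /aff_span_poly[xI x1]; rewrite evB fwG subr0; split.
    by move=> /(fT _ xI); rewrite -JT => xJ; exact: (span_aff_poly dp j0J xJ x1).
  by move=> /aff_span_poly[/fJ].
have [|z [c [zc ec fA]]] := frame_extend (frame_rebase fe AwG) feG BA fAB; first by move=> /(_ _ Ax0).
have rk : r = (1 + k)%N by rewrite -(frame_adim erefl fe) -(frame_adim erefl fA).
have mX := measurable_piece J fe.
subst r; rewrite -(frame_indep erefl fe fA mX).
have mX' := measurable_piece J fA.
rewrite (lattice_heightE zc ec feG fA Ax0 nBx0); last exact: aff_poly0.
rewrite (lattice_volumeE feG); [|exact: aff_poly0|exact: measurable_poly].
have [yv x0E] := frame_split zc ec fA Ax0.
have s0 := ev_col_apex zc ec feG fA Ax0 nBx0.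
set s := ev _ (x0 - wG) in x0E s0 *.
have x0wG : x0 - wG = s *: toR z + yv *m toR eG by rewrite [in LHS]x0E addrC addKr.
set X := frame_coords _ wG (piece J) in mX' *.
pose A' := block_mx (s%:M : 'M[R]_1) yv 0 1%:M : 'M[R]_(1 + k).
have detA : \det A' = s by rewrite /A' det_ublock det1 mulr1 det_scalar1.
have uA : A' \in unitmx by rewrite unitmxE detA unitfE.
set Y := frame_coords eG wG (polytope J).
have mY : measurable (Y : set (borel_rV R k)) by exact: measurable_poly.
pose S : set 'rV[R]_(1 + k) := [set t | X (t *m A' + 0)].
have mS : measurable (S : set (borel_rV R (1 + k))) by exact: measurable_preimage_affine.
have fy (y : 'rV[R]_k) : ev f (y *m toR eG) = 0.
  have /aff_span_poly[/fJ] : aff (polytope J) (wG + y *m toR eG) by exact: frame_mem.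
  by rewrite evD fwG add0r.
have SE sg y : S (cons_rV (sg, y)) <-> piece J (wG + sg *: (x0 - wG) + y *m toR eG).
  rewrite /S /X /frame_coords /= addr0.
  rewrite (_ : cons_rV (sg, y) *m A' = cons_rV (sg * s, sg *: yv + y)); last first.
    rewrite /cons_rV /A' /= (@mul_row_block _ 1 1 k 1 k) mulmx0 addr0 mulmx1 -scalar_mxM.
    by rewrite mul_scalar_mx.
  rewrite mul_row_frame.
  have -> : wG + ((sg * s) *: toR z + (sg *: yv + y) *m toR eG) =
            wG + sg *: (x0 - wG) + y *m toR eG.
    by rewrite x0wG scalerDr scalerA mulmxDl -scalemxAl !addrA.
  by [].
have relE sg y : rel_height J (wG + sg *: (x0 - wG) + y *m toR eG) = sg.
  rewrite !rel_heightD rel_heightZ rel_heightB rel_height_apex//.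
  by rewrite /rel_height -/f fwG fy !mul0r subr0 mulr1 addr0 add0r.
have inA sg y : aff (polytope I) (wG + sg *: (x0 - wG) + y *m toR eG).
  rewrite x0wG scalerDr scalerA scalemxAl.
  have := frame_mem (cons_rV (sg * s, sg *: yv + y)) fA.
  by rewrite mul_row_frame mulmxDl !addrA.
have volX : leb R (1 + k) X = (`|s|%:E * (pyramid_factor R k * leb R k Y))%E.
  rewrite -(leb_affine 0 uA mX') detA; congr (_ * _)%E.
  apply: leb_pyramid => //.
    move=> sg y /SE h; rewrite -(relE sg y); rewrite (piece_le1 dp x0I JO h) andbT.
    by case: h => h _; exact: (rel_height_ge0 JO h).
  move=> sg y sg01; have [h1 h2] := aff_span_poly (inA sg y).
  apply: (iff_trans (SE sg y)); rewrite (pieceE x0I JO h1 h2) relE// /Y /frame_coords /=.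
  have -> // : x0 + (1 - sg)^-1 *: (wG + sg *: (x0 - wG) + y *m toR eG - x0) =
      wG + ((1 - sg)^-1 *: y) *m toR eG.
  have sg1 : 1 - sg != 0 by rewrite subr_eq0 eq_sym lt_eqF//; case/andP: sg01.
  rewrite -scalemxAl; apply/rowP => j; rewrite !mxE; field; exact: sg1.
have [K1 hK1] := bounded_poly dp feG.
have Yfin : leb R k Y \is a fin_num by exact: leb_bounded_fin mY hK1.
have cfin : pyramid_factor R k \is a fin_num.
  by rewrite ge0_fin_numE ?pyramid_factor_lty// ltW// pyramid_factor_gt0.
have /andP[D0 D1] := leb_std_simplex_gt0 R k.
have Dfin : leb R k (@std_simplex R k) \is a fin_num by rewrite ge0_fin_numE// ltW.
rewrite volX [leb R (1 + k) _]leb_std_simplexS !fineM ?fin_numM//=.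
have c0 : fine (pyramid_factor R k) != 0 by rewrite gt_eqF// fine_gt0// pyramid_factor_gt0 pyramid_factor_lty.
have Dn0 : fine (leb R k (@std_simplex R k)) != 0 by rewrite gt_eqF// fine_gt0// D0.
by field; rewrite c0 Dn0.
Qed.

(** The pyramids cover the polytope, and two of them overlap in a null set, on which two distinct
    relative heights agree. *)
Lemma volume_pyramids i j : i \in I -> j \in I -> p i <> p j ->
  lattice_volume (polytope I) =
  \sum_(J in opp_index) lattice_height (aff (polytope J)) x0 * lattice_volume (polytope J).
Proof.
move=> iI jI pij.
have [i1 i1I pi1] : exists2 i1, i1 \in I & p i1 <> x0.
  have [E|E] := pselect (p i = x0); last by exists i.
  by exists j => // pj; apply: pij; rewrite E.
have [r [e fe]] := poly_frame dp iI; set w := toR (v i) in fe.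
rewrite (lattice_volumeE fe); [|exact: aff_poly0|exact: measurable_poly].
have mX := measurable_poly fe.
have [K hK] := bounded_poly dp fe.
have cover : frame_coords e w (polytope I) =
    [set t | exists2 J, J \in enum opp_index & frame_coords e w (piece J) t].
  apply/seteqP; split => t; rewrite /frame_coords /=.
    by move=> /(pieces_cover dp x0I i1I pi1)[J JO]; exists J => //; rewrite mem_enum.
  by move=> [J _ []].
(* The relative heights are 1 at the apex, so if they differ by a constant they are equal. *)
have null J J' : J \in opp_index -> J' \in opp_index -> J != J' ->
    leb R r (frame_coords e w (piece J) `&` frame_coords e w (piece J')) = 0%E.
  move=> JO J'O JJ'; pose g := rel_col J - rel_col J'.
  have gE x : ev g x = rel_height J x - rel_height J' x by rewrite ev_formD ev_formN -!rel_colE.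
  have g0 : toR e *m g != 0.
    apply: contra JJ' => /eqP eg; apply/eqP; apply: (rel_height_inj JO J'O) => l lI.
    have gcst x : aff (polytope I) x -> ev g x = ev g w.
      by move=> /(frame_coord fe)[t ->]; rewrite ev_affine eg mulmx0 mxE addr0.
    apply/eqP; rewrite -subr_eq0 -gE gcst; last by apply: sub_aff; exact: mem_poly.
    by rewrite -(gcst x0); [rewrite gE !rel_height_apex// subrr|exact: sub_aff].
  apply: (@subset_measure0 _ (borel_rV R r) R (leb R r) _ [set t : 'rV[R]_r | (t *m (toR e *m g)) 0 0 = - ev g w]).
  - by apply: measurableI; exact: measurable_piece.
  - exact: measurable_hyperplane.
  - move=> t [[_ h1] [_ h2]] /=; apply/eqP; rewrite -subr_eq0 opprK addrC -ev_affine gE subr_eq0.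
    by rewrite eq_le h1// h2.
  - exact: leb_hyperplane.
rewrite cover measure_null_overlap; first last.
- by move=> J J'; rewrite !mem_enum; exact: null.
- by move=> J _; exact: measurable_piece.
- exact: enum_uniq.
rewrite big_enum /= -sum_fine; last first.
  move=> J _; apply: (leb_bounded_fin (measurable_piece J fe)) => t [tI _].
  exact: hK.
rewrite mulr_suml; apply: eq_bigr => J JO.
have [j0 j0J] := facet_index_neq0 dp iI jI pij (opp_indexP JO).1.
exact: piece_volume JO j0J fe.
Qed.

End Pyramids.

(** * Correctness of the descent *)

(** Turns cardinalities of finite sets into natural numbers, so that a minimum exists. *)
Lemma exists_lex_min_card (I : finType) (P : pred I) T U (a : I -> set T) (b : I -> set U) i0 :
  (forall i, finite_set (a i)) -> (forall i, finite_set (b i)) -> P i0 ->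
  exists2 i, P i & forall j, P j ->
    (a i #<= a j)%card /\ ((a j #<= a i)%card -> (b i #<= b j)%card).
Proof.
move=> fa fb Pi0.
pose ka i := projT1 (cid (fa i)); pose kb i := projT1 (cid (fb i)).
have aE i j : (a i #<= a j)%card = (ka i <= ka j)%N.
  rewrite -card_le_II (card_le_eql (projT2 (cid (fa i)))).
  by rewrite (card_le_eqr (projT2 (cid (fa j)))).
have bE i j : (b i #<= b j)%card = (kb i <= kb j)%N.
  rewrite -card_le_II (card_le_eql (projT2 (cid (fb i)))).
  by rewrite (card_le_eqr (projT2 (cid (fb j)))).
have [i1 Pi1 min1] := arg_minnP ka Pi0.
have Pi1' : P i1 && (ka i1 == ka i1) by rewrite Pi1 eqxx.
have [/= i /andP[Pi /eqP ki] min2] := @arg_minnP _ i1 (fun i => P i && (ka i == ka i1)) kb Pi1'.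
exists i => // j Pj; rewrite !aE bE ki; split; first exact: min1.
by move=> kj; apply: min2; rewrite Pj eqn_leq kj min1.
Qed.

Section DescentCorrectness.
Variables (R : realType) (n m : nat) (v : 'I_m -> 'rV[int]_n) (d : 'cV[R]_n).
Let p i : 'rV[R]_n := toR R (v i).
Hypothesis dp : forall i, ev d (p i) = 1.
Notation polytope := (polytope p d).
Notation face_set := (set (set 'rV[R]_n)).
Notation weight := (set 'rV[R]_n -> R).
Implicit Types (F G : set 'rV[R]_n) (D T : face_set) (w : weight).

(** All faces that the descent meets have this form.  They are polytopes in their own right, which
    spares the transitivity of the face relation. *)
Definition lattice_face F := exists (I : {set 'I_m}) i, i \in I /\ F = polytope I.

Definition lattice_faces D := forall F, D F -> lattice_face F.

(** The number of given points in a face replaces its dimension as a termination measure. *)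
Definition points_of F : {set 'I_m} := finset (fun i => `[< F (p i) >]).

Lemma points_ofP F i : reflect (F (p i)) (i \in points_of F).
Proof. by rewrite finset.in_set; exact: asboolP. Qed.

Lemma finite_lattice_faces D : lattice_faces D -> finite_set D.
Proof.
move=> DL; apply: (@sub_finite_set _ _ (polytope @` [set: {set 'I_m}])).
  by move=> F /DL[I [i [_ ->]]]; exists I.
by apply: finite_image; exact: finite_finset.
Qed.

Lemma not_simplex_points (I : {set 'I_m}) i0 : i0 \in I -> ~ simplex (polytope I) ->
  exists i j, [/\ i \in I, j \in I & p i <> p j].
Proof.
move=> i0I nS; apply: contrapT => h; apply: nS.
rewrite (poly_point dp i0I); first exact: simplex_point.
by move=> j jI; apply: contrapT => ij; apply: h; exists j, i0.
Qed.

(** The empty set is neither a simplex nor has a vertex to continue with.  It is not a facet here,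
    because a polytope that is not a simplex has two distinct points. *)
Lemma facet_lattice_face F G : lattice_face F -> ~ simplex F -> facet F G ->
  lattice_face G /\ (#|points_of G| < #|points_of F|)%N.
Proof.
move=> [I [i0 [i0I FE]]]; rewrite FE => /(not_simplex_points i0I)[i [j [iI jI ij]]].
move=> /(facet_has_form dp)[f fF ->].
have [k kT] := facet_index_neq0 dp iI jI ij (tight_facet_index fF).
split; first by exists (tight p I f), k.
apply: proper_card; apply/properP; split.
  apply/fintype.subsetP => l /points_ofP h; apply/points_ofP.
  exact: (poly_sub (tight_sub p I f) h).
have [fI [l lI fl] _] := fF; exists l; apply/points_ofP; first exact: mem_poly.
by rewrite poly_tightE// => -[_ /= h]; move: fl; rewrite h eqxx.
Qed.

Lemma opposite_lattice_faces F x : lattice_face F -> ~ simplex F ->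
  lattice_faces (opposite_facets F x).
Proof. by move=> FL FS G [/(facet_lattice_face FL FS)[]]. Qed.

Lemma lattice_face_volume F x : lattice_face F -> ~ simplex F -> vertex F x ->
  lattice_volume F =
  \sum_(G \in opposite_facets F x) lattice_height (aff G) x * lattice_volume G.
Proof.
move=> [I [i0 [i0I FE]]]; rewrite FE => /(not_simplex_points i0I)[i [j [iI jI ij]]].
move=> /(vertex_point dp)[k kI ->].
have kF : polytope I (p k) by exact: mem_poly.
rewrite (volume_pyramids dp kF iI jI ij) (opposite_facetsE dp kF) fsbig_image; last first.
  by move=> J J'; rewrite !inE; exact: poly_opp_inj.
rewrite -big_enum [LHS]fsbig_seq ?enum_uniq//=.
have -> : [set` enum (opp_index p I (p k))] = [set` opp_index p I (p k)].
  by apply/seteqP; split => J /=; rewrite mem_enum.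
by [].
Qed.

Lemma exists_selectable D F : lattice_faces D -> D F -> exists x, selectable D F x.
Proof.
move=> DL DF; have [I [i0 [i0I FE]]] := DL _ DF.
have finD := finite_lattice_faces DL.
have [x /[dup] xV] := exists_vertex dp i0I; rewrite -FE => xF.
have [i iI xE] := vertex_point dp xV.
have finO (j : 'I_m) : finite_set (opposite_facets F (p j)).
  apply: (@sub_finite_set _ _ (polytope @` [set: {set 'I_m}])).
    by move=> G []; rewrite FE => /(facet_has_form dp)[f _ ->] _; exists (tight p I f).
  by apply: finite_image; exact: finite_finset.
have finT (j : 'I_m) : finite_set (faces_through D (p j)).
  by apply: sub_finite_set finD => G [].
have Pi : `[< vertex F (p i) >] by apply/asboolP; rewrite -xE.
have [k /asboolP kV kmin] := @exists_lex_min_card _ (fun i => `[< vertex F (p i) >]) _ _ _ _ i finO finT Pi.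
exists (p k); split => // u uV.
have [l _ uE] : exists2 l, l \in I & u = p l by apply: (vertex_point dp); rewrite -FE.
by rewrite uE; apply: kmin; apply/asboolP; rewrite -uE.
Qed.

Let smaller (t s : state R n) := step s t.

Lemma Acc_Return V : Acc smaller (Return n V).
Proof. by constructor => t h; inversion h. Qed.

Definition faces_left T : {set {set 'I_m}} := finset (fun I => `[< T (polytope I) >]).

Lemma faces_leftP T I : reflect (T (polytope I)) (I \in faces_left T).
Proof. by rewrite finset.in_set; exact: asboolP. Qed.

Lemma faces_leftD1 T F : lattice_face F -> T F -> (#|faces_left (T `\ F)| < #|faces_left T|)%N.
Proof.
move=> [I [_ [_ ->]]] TF; apply: proper_card; apply/properP; split.
  by apply/fintype.subsetP => J /faces_leftP[? _]; apply/faces_leftP.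
by exists I; apply/faces_leftP => // -[_ /=]; apply.
Qed.

(** Within a level the set of faces still to be processed shrinks, and the faces under construction
    contain fewer of the given points than those of the level. *)
Lemma Acc_Processing k D w T D' w' V :
  (forall D w V, lattice_faces D -> (forall F, D F -> (#|points_of F| < k)%N) ->
    Acc smaller (Level D w V)) ->
  lattice_faces T -> (forall F, T F -> (#|points_of F| < k.+1)%N) ->
  lattice_faces D' -> (forall F, D' F -> (#|points_of F| < k)%N) ->
  Acc smaller (Processing D w T D' w' V).
Proof.
move=> AccL; have [N] := ubnP #|faces_left T|; elim: N T D' w' V => [|N IH] T D' w' V; first by rewrite ltn0.
rewrite ltnS => TN TL Tk D'L D'k.
have next F : T F -> (#|faces_left (T `\ F)| < N)%N.
  by move=> TF; apply: leq_trans TN; apply: faces_leftD1 => //; exact: TL.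
have subL F : lattice_faces (T `\ F) by move=> G [/TL].
have subk F G : (T `\ F) G -> (#|points_of G| < k.+1)%N by move=> [/Tk].
constructor => t st; inversion st as [| | ?????? F TF SF|?????? F x TF SF sel|]; subst.
- by apply: IH; [exact: next|exact: subL|exact: subk|exact: D'L|exact: D'k].
- apply: IH; [exact: next|exact: subL|exact: subk| |].
    move=> G [/D'L//|]; exact: (opposite_lattice_faces (TL _ TF) SF).
  move=> G [/D'k//|[fG _]].
  have [_ h] := facet_lattice_face (TL _ TF) SF fG.
  by apply: leq_trans h _; rewrite -ltnS; exact: Tk.
- exact: AccL.
Qed.

Lemma Acc_Level k D w V : lattice_faces D -> (forall F, D F -> (#|points_of F| < k)%N) ->
  Acc smaller (Level D w V).
Proof.
elim: k D w V => [|k IH] D w V DL Dk.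
  constructor => t st; inversion st as [|??? D0| | |]; subst; first exact: Acc_Return.
  by exfalso; apply: D0; apply/seteqP; split => F // /Dk.
constructor => t st; inversion st as [|??? D0| | |]; subst; first exact: Acc_Return.
by apply: (@Acc_Processing k) => // F [].
Qed.

Definition weighted_volume D w : R := \sum_(F \in D) w F * lattice_volume F.

(** The invariant of the descent: the volume accumulated so far and the weighted volumes of all
    faces still to be processed add up to the volume of the polytope. *)
Definition accounts_for (vol : R) (s : state R n) : Prop :=
  match s with
  | Level D w V => lattice_faces D /\ V + weighted_volume D w = vol
  | Processing D w T D' w' V =>
      [/\ lattice_faces D, T `<=` D, lattice_faces D' &
          V + weighted_volume T w + weighted_volume D' w' = vol]
  | Return V => V = vol
  end.

Lemma weighted_volumeD1 T w F : lattice_faces T -> T F ->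
  weighted_volume T w = w F * lattice_volume F + weighted_volume (T `\ F) w.
Proof. by move=> /finite_lattice_faces fT TF; rewrite /weighted_volume (fsbigD1 F). Qed.

(** Replacing a face by its facets opposite to a vertex preserves the weighted volume; this is the
    pyramid formula multiplied by the weight of the face.  A facet found before keeps the
    weight it has. *)
Lemma weighted_volume_add_weights w F x D' w' : lattice_face F -> ~ simplex F ->
  vertex F x -> lattice_faces D' ->
  weighted_volume (D' `|` opposite_facets F x) (add_weights w F x D' w') =
  weighted_volume D' w' + w F * lattice_volume F.
Proof.
move=> FL FS Fx D'L; set O := opposite_facets F x.
have finD' := finite_lattice_faces D'L.
have finO : finite_set O by apply: finite_lattice_faces; exact: opposite_lattice_faces.
rewrite (lattice_face_volume FL FS Fx) mulr_fsumr /weighted_volume.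
pose a G := w' G * lattice_volume G.
pose b G := w F * (lattice_height (aff G) x * lattice_volume G).
have E : {in D' `|` O, (fun G => add_weights w F x D' w' G * lattice_volume G) =1
    (fun G => (if G \in D' then a G else 0) + (if G \in O then b G else 0))}.
  move=> G; rewrite inE /add_weights -/O => -[GD|GO].
    rewrite (mem_set GD); case: ifP => _; last by rewrite addr0.
    by rewrite mulrDl /b mulrA.
  rewrite (mem_set GO) mulrDl /b mulrA; case: ifP => _ //.
  by rewrite mul0r.
have finU : finite_set (D' `|` O) by rewrite finite_setU.
rewrite (eq_fsbigr _ _ E) fsbig_split//=; congr (_ + _); rewrite -fsbig_mkcondr.
  by rewrite (_ : (D' `|` O) `&` D' = D')//; apply/seteqP; split => G /=; tauto.
by rewrite (_ : (D' `|` O) `&` O = O)//; apply/seteqP; split => G /=; tauto.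
Qed.

Lemma step_accounts_for vol s t : step s t -> accounts_for vol s -> accounts_for vol t.
Proof.
case=> /=.
- by move=> w V [_]; rewrite /weighted_volume fsbig_set0 addr0.
- move=> D w V _ [DL <-]; split => //.
  by rewrite {2}/weighted_volume fsbig_set0 addr0.
- move=> D w T D' w' V F TF SF [DL TD D'L <-]; split => //; first by move=> G [/TD].
  rewrite (@weighted_volumeD1 T w F) ?addrA// => G /TD; exact: DL.
- move=> D w T D' w' V F x TF SF [xF _] [DL TD D'L <-].
  have FL := DL _ (TD _ TF); have TL : lattice_faces T by move=> G /TD /DL.
  split => //; first by move=> G [/TD].
    by move=> G [/D'L//|]; exact: opposite_lattice_faces.
  rewrite weighted_volume_add_weights// (weighted_volumeD1 w TL TF).
  by rewrite !addrA [in LHS](addrAC _ _ (w F * _)) -!addrA; congr (_ + _); rewrite !addrA; ring.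
- by move=> D w D' w' V [_ _ D'L]; rewrite {1}/weighted_volume fsbig_set0 addr0 => <-.
Qed.

(** A face that is not a simplex has a vertex, and finitely many candidates have one that is
    minimal, so a state other than a final one always allows a step. *)
Lemma accounts_for_progress vol s : accounts_for vol s ->
  (forall t, ~ step s t) -> s = Return n vol.
Proof.
case: s => [D w V|D w T D' w' V|V] /=.
- move=> _ stuck; exfalso; have [D0|D0] := pselect (D = set0).
    by rewrite D0 in stuck; exact: (stuck _ (step_stop _ _)).
  exact: (stuck _ (step_start _ _ D0)).
- move=> [DL TD _ _] stuck; exfalso; have [T0|/eqP/set0P[F TF]] := pselect (T = set0).
    by rewrite T0 in stuck; exact: (stuck _ (step_next _ _ _ _ _)).
  have [SF|SF] := pselect (simplex F).
    exact: (stuck _ (step_simplex _ _ _ _ _ TF SF)).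
  have [x xF] := exists_selectable DL (TD _ TF).
  exact: (stuck _ (step_descend _ _ _ _ TF SF xF)).
- by move=> ->.
Qed.

Lemma descent_computes_volume i0 (I : {set 'I_m}) : i0 \in I ->
  descent_computes (polytope I) (lattice_volume (polytope I)).
Proof.
move=> i0I.
have PL : lattice_faces [set polytope I] by move=> _ ->; exists I, i0.
split.
  by apply: (@Acc_Level m.+1) => // F _; rewrite ltnS -[X in (_ <= X)%N]card_ord max_card.
move=> s run; apply: accounts_for_progress.
have : accounts_for (lattice_volume (polytope I)) (initial (polytope I)).
  by split => //; rewrite add0r /weighted_volume fsbig_set1 mul1r.
elim: run => [s1 s2 st|//|s1 s2 s3 _ IH1 _ IH2 /IH1/IH2//].
exact: step_accounts_for.
Qed.

End DescentCorrectness.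

Theorem proposition5 (R : realType) (n m : nat) (v : 'I_m -> 'rV[int]_n)
    (delta : {scalar 'rV[R]_n})
    (C_pointed : pointed (cone R v))
    (C_neq0 : cone R v <> [set 0])
    (delta_primitive : primitive_form [set: 'rV[int]_n] delta)
    (delta_gt0 : forall x, cone R v x -> x <> 0 -> 0 < delta x)
    (delta_v : forall i, delta (toR R (v i)) = 1) :
  let P := cone R v `&` [set x | delta x = 1] in
  descent_computes P (lattice_volume P).
Proof.
move=> P.
have dp i : ev (form_col delta) (toR R (v i)) = 1 by rewrite ev_form_col.
have [i0] : exists i0 : 'I_m, i0 \in [set: 'I_m]%SET.
  apply: contrapT => h; apply: C_neq0; apply/seteqP; split => [x [c _ ->]|_ ->] /=.
    by rewrite big1// => i _; exfalso; apply: h; exists i; rewrite inE.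
  by exists (fun=> 0) => //; rewrite big1// => i _; rewrite scale0r.
have -> : P = polytope (fun i => toR R (v i)) (form_col delta) [set: 'I_m]%SET.
  apply/seteqP; split => x; rewrite /P /polytope /= ev_form_col.
    move=> [[c c0 xE] x1]; split => //; exists c; split => // i.
    by rewrite inE.
  by move=> [[c [c0 _ xE]] x1]; split => //; exists c.
exact: descent_computes_volume.
Qed.
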